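(* Let $G$ be a finite group, $H$ a normal subgroup of prime index $p$, $a\in G\setminus H$, $\mathbb{F}$ a field, and $V$ a $G$-stable irreducible $\mathbb{F}H$-module with $\mathbb{F}$-basis $e_0,\dots,e_{d-1}$, representation $\sigma\colon H\to\mathrm{GL}(V)$ and $\Delta=\mathrm{End}_{\mathbb{F}H}(V)$. Let $\alpha\in\mathrm{Aut}_{\mathbb{F}}(V)$ satisfy $(aha^{-1})\sigma=\alpha(h\sigma)\alpha^{-1}$ for all $h\in H$, and put $\lambda=\alpha^{-p}(a^p\sigma)\in\Delta^\times$. Suppose that the restriction of the automorphism $\delta\mapsto\alpha(\delta)=\alpha^{-1}\delta\alpha$ of $\Delta$ to the centre $Z=Z(\Delta)$ has order $p$. (a) If the equation $\mu^{\sqsupset p}=\lambda^{-1}$ has no solution $\mu\in\Delta^\times$, then $V{\uparrow}$ is irreducible, and $\mathrm{End}_{\mathbb{F}G}(V{\uparrow})$ is isomorphic to the general cyclic algebra $(\Delta,\alpha,\lambda)$ via $\sum_{i=0}^{p-1}\delta_ix^i\mapsto\sum_{i=0}^{p-1}D(\delta_i)X^i$. (b) If there is $\mu\in\Delta^\times$ with $\mu^{\sqsupset p}=\lambda^{-1}$, then there are $\mu_0,\dots,\mu_{p-1}\in\Delta^\times$ with $\mu_j^{\sqsupset p}=\lambda^{-1}$ for each $j$ such that $V{\uparrow}=U(\mu_0)\dotplus\cdots\dotplus U(\mu_{p-1})$ (internal direct sum), where $$U(\mu_j)=V\sum_{i=0}^{p-1}\mu_j^{\sqsupset i}\alpha^{-i}a^i\qquad(j=0,1,\dots,p-1)$$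 are isomorphic irreducible $\mathbb{F}G$-submodules whose restrictions to $H$ satisfy $U(\mu_j){\downarrow}\cong V$. Moreover, for $\mu\in\Delta^\times$ with $\mu^{\sqsupset p}=\lambda^{-1}$, if $\rho\colon G\to\mathrm{GL}(U(\mu))$ is the representation afforded by $U(\mu)$ relative to the basis $e'_0,\dots,e'_{d-1}$, where $$e'_j=e_j\sum_{i=0}^{p-1}\mu^{\sqsupset i}\alpha^{-i}a^i\qquad(j=0,1,\dots,d-1),$$ then $a\rho=\alpha\mu^{-1}$, $h\rho=h\sigma$ for $h\in H$, and $$\mathrm{End}_{\mathbb{F}G}(U(\mu))=C_\Delta(\alpha\mu^{-1})=\{\delta\in\Delta\mid\delta^\alpha=\delta^\mu\}.$$
   Context: Conventions: modules are right modules; linear maps are written on the right and composed from left to right (so $v(\varphi\psi)=(v\varphi)\psi$), and matrices act on row vectors from the right, so endomorphism algebras are identified with algebras of matrices under matrix multiplication. $\sigma$ is the representation with $vh=v(h\sigma)$. $V$ is $G$-stable if for each $g\in G$ the representation $h\mapsto(ghg^{-1})\sigma$ of $H$ is equivalent to $\sigma$; this guarantees that some $\alpha$ as in the claim exists. $\Delta$ is a division algebra, finite-dimensional over $\mathbb{F}$. $V{\uparrow}=V\otimes_{\mathbb{F}H}\mathbb{F}G$ is the induced module and ${\downarrow}$ denotes restriction to $H$. Write $va^i$ for $v\otimes a^i\in V{\uparrow}$; for $\beta_i\in\mathrm{End}_{\mathbb{F}}(V)$, $v\sum_i\beta_ia^i$ means $\sum_i(v\beta_i)\otimes a^i$, and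 $V\sum_i\beta_ia^i=\{v\sum_i\beta_ia^i\mid v\in V\}$. We write $\delta^\beta=\beta^{-1}\delta\beta$. The element $\lambda$ satisfies $\alpha(\lambda)=\lambda$ and $\alpha^p(\delta)=\lambda\delta\lambda^{-1}$ for $\delta\in\Delta$. $C_\Delta(\beta)$ is the set of $\delta\in\Delta$ commuting with $\beta$; the description of $\mathrm{End}_{\mathbb{F}G}(U(\mu))$ is as matrices relative to the basis $e'_0,\dots,e'_{d-1}$. Left-twisted powers: for $\mu\in\Delta$, $\mu^{\sqsupset 0}=1$ and $\mu^{\sqsupset(i+1)}=\mu^{\sqsupset i}\alpha^i(\mu)=\mu\,\alpha(\mu^{\sqsupset i})$ for $i\ge0$; equivalently $(\mu t)^i=\mu^{\sqsupset i}t^i$ in $\Delta[t;\alpha]$. Here $\Delta[t;\alpha]$ is the twisted polynomial ring with $t\delta=\alpha(\delta)t$, and the general cyclic algebra $(\Delta,\alpha,\lambda)$ is the quotient of $\Delta[t;\alpha]$ by the two-sided ideal $(t^p-\lambda)\Delta[t;\alpha]$; its elements are uniquely $\sum_{i=0}^{p-1}\delta_ix^i$, where $x$ is the image of $t$, $x^p=\lambda$, $x\delta=\alpha(\delta)x$. The matrices $D(\delta)$ and $X$ are the following $p\times p$ block matrices relative to the basis $e_0,\dots,e_{d-1},\dots,e_0\alpha^{-i}a^i,\dots,e_{d-1}\alpha^{-i}a^i,\dots,e_{d-1}\alpha^{-(p-1)}a^{p-1}$ of $V{\uparrow}$: $D(\delta)=\mathrm{diag}(\delta,\alpha(\delta),\dots,\alpha^{p-1}(\delta))$,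 and $X$ has identity blocks on the block superdiagonal, $\lambda$ in the bottom-left block, and zeros elsewhere. *)

(* Defs.v *)
From HB Require Import structures.
From mathcomp Require Import all_boot all_order all_algebra.
From mathcomp Require Import all_fingroup cyclic mxrepresentation.
From mathcomp Require Import generic_quotient ring_quotient.
From mathcomp Require Import boolp.

Set Implicit Arguments.
Unset Strict Implicit.
Unset Printing Implicit Defensive.

Import GroupScope GRing.Theory.
Local Open Scope ring_scope.

(* Modules are right modules and matrices act on row vectors from the right, *)
(* as in mxrepresentation: composition of linear maps from left to right is   *)
(* the matrix product.                                                        *)

(* The twisted polynomial ring D[t; alpha], with t * delta = alpha delta * t. *)
(* Its additive group is that of {poly D} (coefficients on the left of the    *)
(* powers of t), but it carries its own multiplication.                       *)
Definition skew_poly (D : nzRingType) (alpha : {rmorphism D -> D}) : Type :=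
  {poly D}.

Section SkewPoly.
Variables (D : nzRingType) (alpha : {rmorphism D -> D}).
Local Notation S := (skew_poly alpha).
Implicit Types f g h : S.

HB.instance Definition _ := GRing.Zmodule.on S.

Definition skew_mul f g : S :=
  \poly_(k < size (f : {poly D}) + size (g : {poly D}))
     \sum_(i < k.+1) (f : {poly D})`_i * iter i alpha (g : {poly D})`_(k - i).

Lemma iter_rmorph_sum I (r : seq I) (P : pred I) (E : I -> D) i :
  iter i alpha (\sum_(j <- r | P j) E j) = \sum_(j <- r | P j) iter i alpha (E j).
Proof. by elim: i => //= i ->; rewrite rmorph_sum. Qed.
Lemma iter_rmorphM i : {morph iter i alpha : x y / x * y}.
Proof. by elim: i => // i IH x y; rewrite !iterS IH rmorphM. Qed.
Lemma iter_rmorphD i : {morph iter i alpha : x y / x + y}.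
Proof. by elim: i => // i IH x y; rewrite !iterS IH rmorphD. Qed.
Lemma iter_rmorph0 i : iter i alpha 0 = 0.
Proof. by elim: i => //= i ->; rewrite rmorph0. Qed.
Lemma iter_rmorph1 i : iter i alpha 1 = 1.
Proof. by elim: i => //= i ->; rewrite rmorph1. Qed.

Lemma coef_skew_mul f g k : (skew_mul f g : {poly D})`_k =
  \sum_(i < k.+1) (f : {poly D})`_i * iter i alpha (g : {poly D})`_(k - i).
Proof.
rewrite coef_poly; case: ltnP => // le_fg_k.
rewrite big1 // => j _; have [le_f_j|lt_j_f] := leqP (size (f : {poly D})) j.
  by rewrite nth_default ?mul0r.
rewrite [X in iter _ _ X]nth_default ?iter_rmorph0 ?mulr0 //.
rewrite leq_subRL; last by rewrite -ltnS.
by apply: leq_trans le_fg_k; rewrite leq_add2r ltnW.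
Qed.

Lemma coef_skew_mul_rev f g k : (skew_mul f g : {poly D})`_k =
  \sum_(i < k.+1) (f : {poly D})`_(k - i) * iter (k - i) alpha (g : {poly D})`_i.
Proof.
rewrite coef_skew_mul (reindex_inj rev_ord_inj) /=.
by apply: eq_bigr => j _; rewrite (sub_ordK j).
Qed.

Lemma skew_mulA : associative skew_mul.
Proof.
move=> p q r; apply/polyP=> i; rewrite coef_skew_mul coef_skew_mul_rev.
pose coef3 j k := (p : {poly D})`_j * (iter j alpha (q : {poly D})`_(i - j - k)
  * iter (i - k) alpha (r : {poly D})`_k).
transitivity (\sum_(j < i.+1) \sum_(k < i.+1 | (k <= i - j)%N) coef3 j k).
  apply: eq_bigr => /= j _; rewrite coef_skew_mul_rev iter_rmorph_sum big_distrr.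
  rewrite /= (big_ord_narrow_leq (leq_subr _ _)) /=; apply: eq_bigr => k _.
  rewrite iter_rmorphM -iterD /coef3; congr (_ * (_ * iter _ _ _)).
  have jk := ltn_ord k; have jj := ltn_ord j.
  rewrite ltnS in jk; rewrite ltnS in jj; rewrite addnBA //.
  by rewrite subnKC.
rewrite (exchange_big_dep predT) //=; apply: eq_bigr => k _.
transitivity (\sum_(j < i.+1 | (j <= i - k)%N) coef3 j k).
  apply: eq_bigl => j; rewrite -ltnS -(ltnS j) -!subSn ?leq_ord //.
  by rewrite -subn_gt0 -(subn_gt0 j) -!subnDA addnC.
rewrite (big_ord_narrow_leq (leq_subr _ _)) coef_skew_mul big_distrl /=.
by apply: eq_bigr => j _; rewrite /coef3 -!subnDA addnC mulrA.
Qed.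

Lemma skew_mul1l : left_id (1%:P : S) skew_mul.
Proof.
move=> p; apply/polyP => i; rewrite coef_skew_mul big_ord_recl subn0.
by rewrite big1 => [|j _]; rewrite coefC /= ?mul1r ?mul0r ?addr0.
Qed.

Lemma skew_mul1r : right_id (1%:P : S) skew_mul.
Proof.
move=> p; apply/polyP => i; rewrite coef_skew_mul_rev big_ord_recl subn0.
rewrite big1 => [|j _]; rewrite coefC /= ?iter_rmorph1 ?mulr1 ?addr0 //.
by rewrite iter_rmorph0 mulr0.
Qed.

Lemma skew_mulDl : left_distributive skew_mul +%R.
Proof.
move=> p q r; apply/polyP=> i; rewrite coefD !coef_skew_mul -big_split.
by apply: eq_bigr => j _; rewrite coefD mulrDl.
Qed.

Lemma skew_mulDr : right_distributive skew_mul +%R.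
Proof.
move=> p q r; apply/polyP=> i; rewrite coefD !coef_skew_mul -big_split.
by apply: eq_bigr => j _; rewrite coefD iter_rmorphD mulrDr.
Qed.

Lemma skew_1_neq0 : (1%:P : S) != 0.
Proof. exact: poly1_neq0. Qed.

HB.instance Definition _ := GRing.Zmodule_isNzRing.Build S
  skew_mulA skew_mul1l skew_mul1r skew_mulDl skew_mulDr skew_1_neq0.

Definition skewC (delta : D) : S := delta%:P.
Definition skewT : S := 'X.

Lemma skewTC delta : skewT * skewC delta = skewC (alpha delta) * skewT.
Proof.
apply/polyP=> k; rewrite [LHS]coef_skew_mul [RHS]coef_skew_mul.
rewrite big_ord_recl coefX mul0r add0r [RHS]big_ord_recl [X in _ = _ + X]big1.
  rewrite addr0 subn0 /= coefC coefX eqxx; case: k => [|k].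
    by rewrite big_ord0 mulr0.
  rewrite big_ord_recl /= coefX mul1r subSS subn0 coefC big1 => [|j _].
    by rewrite addr0 eqSS; case: (k == 0%N); rewrite ?mulr1 ?mulr0 ?rmorph0.
  by rewrite coefX mul0r.
by move=> j _; rewrite coefC mul0r.
Qed.

Lemma skewC_is_zmod : zmod_morphism skewC.
Proof. exact: polyCB. Qed.
Lemma skewC_is_monoid : monoid_morphism skewC.
Proof.
split=> // x y; apply/polyP=> k; rewrite [RHS]coef_skew_mul big_ord_recl big1.
  by rewrite !coefC subn0 addr0 /=; case: (k == 0%N); rewrite ?mulr0.
by move=> j _; rewrite coefC mul0r.
Qed.
HB.instance Definition _ := GRing.isZmodMorphism.Build D S skewC skewC_is_zmod.
HB.instance Definition _ :=
  GRing.isMonoidMorphism.Build D S skewC skewC_is_monoid.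

Lemma skewCT_coef delta k j :
  (skewC delta * skewT ^+ k : {poly D})`_j = delta *+ (j == k).
Proof.
elim: k delta j => [|k IH] delta j.
  by rewrite expr0 mulr1 coefC; case: (j == 0%N).
rewrite exprSr mulrA [LHS]coef_skew_mul; case: j => [|j].
  by rewrite big_ord1 coefX iter_rmorph0 mulr0.
rewrite big_ord_recr /= subnn [X in iter _ _ X]coefX.
rewrite [X in _ + _ * alpha X]iter_rmorph0 rmorph0 mulr0 addr0.
rewrite big_ord_recr /= IH subSn // subnn coefX iter_rmorph1 mulr1 big1 ?add0r.
  by rewrite eqSS.
move=> i _; rewrite coefX; case: i => i lt_ij /=.
suff /negPf->: (j.+1 - i != 1)%N by rewrite iter_rmorph0 mulr0.
by rewrite subSn 1?ltnW // eqSS subn_eq0 -ltnNge.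
Qed.

Lemma skewE f : f = \sum_(i < size (f : {poly D})) skewC (f : {poly D})`_i * skewT ^+ i.
Proof.
apply/polyP=> k; rewrite coef_sum.
under eq_bigr do rewrite skewCT_coef.
case: (ltnP k (size (f : {poly D}))) => kf.
  rewrite (bigD1 (Ordinal kf)) //= eqxx big1 ?addr0 // => i.
  by rewrite -val_eqE /= eq_sym => /negPf->.
rewrite nth_default // big1 // => i _; suff /negPf->: k != i by [].
by rewrite neq_ltn (leq_trans (ltn_ord i)) ?orbT.
Qed.
End SkewPoly.

Record cyclic_datum (D : unitRingType) (alpha : {rmorphism D -> D}) (lam : D)
  (p : nat) : Prop := CyclicDatum {
  cyclic_unit : lam \is a GRing.unit;
  cyclic_fix : alpha lam = lam;
  cyclic_inner : forall delta, iter p alpha delta = lam * delta * lam^-1 }.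

(* The right ideal (t^p - lam) D[t; alpha], which is two-sided under the      *)
(* conditions on lam.                                                         *)
Definition cyclic_ideal (D : unitRingType) (alpha : {rmorphism D -> D}) (lam : D)
    (p : nat) of cyclic_datum alpha lam p : {pred skew_poly alpha} :=
  fun f => `[< exists g : skew_poly alpha,
                 f = (skewT alpha ^+ p - skewC alpha lam) * g >].

Section CyclicAlgebra.
Variables (D : unitRingType) (alpha : {rmorphism D -> D}) (lam : D) (p : nat).
Variable dat : cyclic_datum alpha lam p.
Local Notation S := (skew_poly alpha).
Local Notation I := (cyclic_ideal dat).

Lemma cyclic_idealP f :
  reflect (exists g : S, f = (skewT alpha ^+ p - skewC alpha lam) * g) (f \in I).
Proof. exact: asboolP. Qed.

Lemma cyclic_ideal_zmod : zmod_closed I.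
Proof.
split; first by apply/cyclic_idealP; exists 0; rewrite mulr0.
move=> f g /cyclic_idealP[f' ->] /cyclic_idealP[g' ->].
by apply/cyclic_idealP; exists (f' - g'); rewrite mulrBr.
Qed.
HB.instance Definition _ := GRing.isZmodClosed.Build S I cyclic_ideal_zmod.

Lemma cyclic_idealMr f g : f \in I -> f * g \in I.
Proof.
move=> /cyclic_idealP[h ->]; apply/cyclic_idealP; exists (h * g).
by rewrite mulrA.
Qed.

Lemma skewTnC n delta : skewT alpha ^+ n * skewC alpha delta =
  skewC alpha (iter n alpha delta) * skewT alpha ^+ n.
Proof.
elim: n delta => [|n IH] delta; first by rewrite !expr0 mul1r mulr1.
by rewrite exprSr -mulrA skewTC mulrA IH -mulrA -iterSr.
Qed.

Lemma cyclic_idealMl f g : g \in I -> f * g \in I.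
Proof.
set c := (skewT alpha ^+ p - skewC alpha lam).
move=> /cyclic_idealP[h ->]; rewrite mulrA; apply: cyclic_idealMr.
have cC delta : skewC alpha delta * c \in I.
  apply/cyclic_idealP; exists (skewC alpha (lam^-1 * delta * lam)).
  rewrite mulrBr mulrBl skewTnC (cyclic_inner dat) -!rmorphM /=.
  have U := cyclic_unit dat.
  by rewrite !mulrA divrr ?mul1r // mulrK // divrr // mul1r.
have cT k : skewT alpha ^+ k * c = c * skewT alpha ^+ k.
  rewrite mulrBr mulrBl -!exprD addnC skewTnC; congr (_ - skewC _ _ * _).
  by elim: k => //= k ->; exact: cyclic_fix dat.
rewrite [f]skewE mulr_suml rpred_sum // => i _.
by rewrite -mulrA cT mulrA cyclic_idealMr.
Qed.

Definition cyclic_alg : Type := Quotient.quot I.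

HB.instance Definition _ := GRing.Zmodule.on cyclic_alg.
HB.instance Definition _ := EqQuotient.on cyclic_alg.

Local Notation A := cyclic_alg.
Local Open Scope quotient_scope.
Definition cyclic_one : A := lift_cst A 1.
Definition cyclic_mul : A -> A -> A := lift_op2 A *%R.

Canonical pi_cyclic_one := PiConst cyclic_one.
Lemma pi_cyclic_mul : {morph \pi_A : x y / x * y >-> cyclic_mul x y}.
Proof.
move=> x y; unlock cyclic_mul; apply/eqP; rewrite piE Quotient.equivE.
rewrite -[_ * _](addrNK (x * repr (\pi_A y))) -mulrBr.
rewrite -addrA -mulrBl rpredD //.
  by rewrite cyclic_idealMl // Quotient.idealrDE opprK reprK.
by rewrite cyclic_idealMr // Quotient.idealrDE opprK reprK.
Qed.
Canonical pi_cyclic_mul_morph := PiMorph2 pi_cyclic_mul.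

Lemma cyclic_mulA : associative cyclic_mul.
Proof. by move=> x y z; rewrite -[x]reprK -[y]reprK -[z]reprK !piE mulrA. Qed.
Lemma cyclic_mul1l : left_id cyclic_one cyclic_mul.
Proof. by move=> x; rewrite -[x]reprK !piE mul1r. Qed.
Lemma cyclic_mul1r : right_id cyclic_one cyclic_mul.
Proof. by move=> x; rewrite -[x]reprK !piE mulr1. Qed.
Lemma cyclic_mulDl : left_distributive cyclic_mul +%R.
Proof.
move=> x y z; rewrite -[x]reprK -[y]reprK -[z]reprK.
by rewrite !piE mulrDl.
Qed.
Lemma cyclic_mulDr : right_distributive cyclic_mul +%R.
Proof.
move=> x y z; rewrite -[x]reprK -[y]reprK -[z]reprK.
by rewrite !piE mulrDr.
Qed.
HB.instance Definition _ := GRing.Zmodule_isPzRing.Build A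
  cyclic_mulA cyclic_mul1l cyclic_mul1r cyclic_mulDl cyclic_mulDr.

Definition cyclic_pi (f : S) : A := \pi_A f.
Lemma cyclic_pi_is_zmod : zmod_morphism cyclic_pi.
Proof. by move=> x y; rewrite /cyclic_pi !piE. Qed.
Lemma cyclic_pi_is_monoid : monoid_morphism cyclic_pi.
Proof. by split=> [|x y]; rewrite /cyclic_pi !piE. Qed.
HB.instance Definition _ :=
  GRing.isZmodMorphism.Build S A cyclic_pi cyclic_pi_is_zmod.
HB.instance Definition _ :=
  GRing.isMonoidMorphism.Build S A cyclic_pi cyclic_pi_is_monoid.
Lemma cyclic_pi_eq f g : (cyclic_pi f = cyclic_pi g) <-> (f - g \in I).
Proof. by rewrite Quotient.idealrBE; split=> [/eqP|/eqP]. Qed.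

Definition cyclicC (delta : D) : A := cyclic_pi (skewC alpha delta).
Definition cyclicX : A := cyclic_pi (skewT alpha).
End CyclicAlgebra.

(* Left-twisted powers: mu alpha(mu) ... alpha^(i-1)(mu).                     *)
Fixpoint left_pow (D : nzRingType) (alpha : D -> D) (mu : D) (i : nat) : D :=
  if i is i'.+1 then left_pow alpha mu i' * iter i' alpha mu else 1.

Lemma left_powSl (D : nzRingType) (alpha : {rmorphism D -> D}) mu i :
  left_pow alpha mu i.+1 = mu * alpha (left_pow alpha mu i).
Proof.
elim: i => [|i IH]; first by rewrite /= rmorph1 mulr1 mul1r.
rewrite -[left_pow _ _ i.+2]/(left_pow alpha mu i.+1 * iter i.+1 alpha mu).
by rewrite [in LHS]IH -mulrA -rmorphM.
Qed.

Lemma left_powE (D : nzRingType) (alpha : {rmorphism D -> D}) mu i :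
  (skewC alpha mu * skewT alpha) ^+ i =
  skewC alpha (left_pow alpha mu i) * skewT alpha ^+ i.
Proof.
elim: i => [|i IH]; first by rewrite !expr0 mulr1 rmorph1.
rewrite exprS IH -mulrA [X in _ * X]mulrA skewTC.
by rewrite -mulrA -exprS mulrA -rmorphM -left_powSl.
Qed.

Definition central (D : nzRingType) (z : D) := forall x : D, z * x = x * z.

Definition order_on_center (D : nzRingType) (f : D -> D) (n : nat) :=
  [/\ (0 < n)%N,
      forall z, central z -> iter n f z = z
    & forall k, (0 < k < n)%N -> exists2 z, central z & iter k f z <> z].

Section Endomorphisms.
Variables (F : fieldType) (gT : finGroupType) (G : {group gT}) (n : nat).
Variable rG : mx_representation F G n.

Record endo := Endo { endo_mx :> 'M[F]_n; endoP : centgmx rG endo_mx }.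

HB.instance Definition _ := [isSub for endo_mx].
HB.instance Definition _ := [Choice of endo by <:].

Lemma centgmx_subring : subring_closed (centgmx rG).
Proof.
split=> [|A B /centgmxP cA /centgmxP cB|A B /centgmxP cA /centgmxP cB].
- by apply/centgmxP=> x _; rewrite mulmx1 mul1mx.
- by apply/centgmxP=> x Gx; rewrite mulmxBl mulmxBr cA ?cB.
- apply/centgmxP=> x Gx.
  by rewrite -[A * B]/(A *m B) -mulmxA cB // !mulmxA cA.
Qed.
HB.instance Definition _ :=
  GRing.isSubringClosed.Build 'M[F]_n (centgmx rG) centgmx_subring.
Lemma centgmx_scale : GRing.scaler_closed (centgmx rG).
Proof.
move=> c A /centgmxP cA.
by apply/centgmxP=> x Gx; rewrite -scalemxAl cA // -scalemxAr.
Qed.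
HB.instance Definition _ :=
  GRing.isScaleClosed.Build F 'M[F]_n (centgmx rG) centgmx_scale.
HB.instance Definition _ := GRing.SubChoice_isSubPzRing.Build _ _ endo centgmx_subring.
HB.instance Definition _ := [SubZmodule_isSubLmodule of endo by <:].
End Endomorphisms.

Section DivisionEndomorphisms.
Variables (F : fieldType) (gT : finGroupType) (G : {group gT}) (d : nat).
Variable rG : mx_representation F G d.+1.

Lemma centgmx_divring : divring_closed (centgmx rG).
Proof.
have [c1 cB cM] := centgmx_subring rG; split=> // A B cA /centgmxP cB'.
apply: cM => //; apply/centgmxP=> x Gx; apply/esym.
by apply: (@commrV _ (rG x : 'M_d.+1) B); apply/esym/cB'.
Qed.
HB.instance Definition _ :=
  GRing.SubPzSemiRing_isNonZero.Build 'M[F]_d.+1 (centgmx rG) (endo rG).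
HB.instance Definition _ :=
  GRing.SubNzRing_isSubUnitRing.Build _ _ (endo rG) centgmx_divring.
End DivisionEndomorphisms.

Record prime_extension (gT : finGroupType) (G H : {group gT}) (p : nat)
    (a : gT) : Prop := PrimeExtension {
  ext_normal : H <| G;
  ext_prime : prime p;
  ext_index : #|G : H|%g = p;
  ext_elt : a \in G :\: H }.

Section ConjugateRepr.
Variables (F : fieldType) (gT : finGroupType) (H : {group gT}) (n : nat).
Variable sigma : mx_representation F H n.
Variables (g : gT) (nHg : g \in 'N(H)).

Lemma conj_mx_repr : mx_repr H (fun h => sigma (g * h * g^-1)%g).
Proof.
have inH h : h \in H -> (g * h * g^-1)%g \in H.
  move=> Hh; have: (h ^ g^-1)%g \in H by rewrite memJ_norm ?groupV.
  by rewrite conjgE invgK mulgA.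
split=> [|h k Hh Hk]; first by rewrite mulg1 mulgV repr_mx1.
by rewrite -repr_mxM ?inH // !mulgA mulgKV.
Qed.
Definition conj_repr := MxRepresentation conj_mx_repr.
End ConjugateRepr.

Definition stable_repr (F : fieldType) (gT : finGroupType) (G H : {group gT})
    (n : nat) (sigma : mx_representation F H n) :=
  forall (g : gT) (nHg : g \in 'N(H)), g \in G ->
    mx_rsim (conj_repr sigma nHg) sigma.

Record twisting (F : fieldType) (gT : finGroupType) (H : {group gT}) (a : gT)
    (d : nat) (sigma : mx_representation F H d.+1) (alpha : 'M[F]_d.+1) : Prop :=
  Twisting {
    twist_unit : alpha \is a GRing.unit;
    twistE : forall h, h \in H ->
      sigma (a * h * a^-1)%g = alpha * sigma h * alpha^-1 }.
Arguments twisting {F gT H} a {d} sigma alpha.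

Section PrimeExtension.
Variables (gT : finGroupType) (G H : {group gT}) (p : nat) (a : gT).
Hypothesis ext : prime_extension G H p a.

Lemma ext_norm : a \in 'N(H).
Proof.
by apply: (subsetP (normal_norm (ext_normal ext))); have /setDP[] := ext_elt ext.
Qed.
Lemma ext_sub : H \subset G.
Proof. exact: normal_sub (ext_normal ext). Qed.
Lemma ext_inG : a \in G.
Proof. by have /setDP[] := ext_elt ext. Qed.

Lemma coset_order : #[coset H a] = p.
Proof.
have nHG := normal_norm (ext_normal ext).
have oGH : #|G / H|%g = p by rewrite card_quotient // (ext_index ext).
have aGH : coset H a \in (G / H)%g by rewrite mem_quotient ?ext_inG.
have := order_dvdG aGH; rewrite oGH.
have [_ dv] := primeP (ext_prime ext).
move=> /dv /orP[|/eqP//]; rewrite order_eq1 => /eqP a1.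
have := coset_idr ext_norm a1; have /setDP[_ /negPf->] := ext_elt ext.
by [].
Qed.

Lemma mem_expH i : ((a ^+ i)%g \in H) = (p %| i)%N.
Proof.
have nHi : (a ^+ i)%g \in 'N(H) by rewrite groupX // ext_norm.
rewrite -coset_order order_dvdn -morphX ?ext_norm //.
apply/idP/eqP=> [|/coset_idr]; [exact: coset_id|exact].
Qed.

Lemma mem_apH : (a ^+ p)%g \in H.
Proof. by rewrite mem_expH. Qed.

Lemma memH_exp_mul (i j : 'I_p) : ((a ^+ i * (a ^+ j)^-1)%g \in H) = (i == j).
Proof.
wlog le_ij : i j / (j <= i)%N.
  move=> IH; case: (leqP j i) => [/IH //|/ltnW/IH].
  by rewrite -groupV invMg invgK eq_sym.
have -> : (a ^+ i * (a ^+ j)^-1 = a ^+ (i - j))%g.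
  by apply: (mulIg (a ^+ j)%g); rewrite mulgKV -expgD subnK.
rewrite mem_expH -val_eqE /= eqn_leq le_ij andbT -subn_eq0.
apply/idP/idP=> [|/eqP->//].
case: (posnP (i - j)%N) => [->//|gt0 /(dvdn_leq gt0)].
by rewrite leqNgt (leq_ltn_trans (leq_subr _ _)).
Qed.

Lemma transversal g : g \in G -> exists i : 'I_p, (g * (a ^+ i)^-1)%g \in H.
Proof.
move=> Gg; have nHG := normal_norm (ext_normal ext).
have gN := subsetP nHG _ Gg.
have oGH : #|G / H|%g = p by rewrite card_quotient // (ext_index ext).
have aGH : coset H a \in (G / H)%g by rewrite mem_quotient ?ext_inG.
have cGH : (G / H)%g = <[coset H a]>%g.
  apply/esym/eqP; rewrite eqEcard cycle_subG aGH oGH /=.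
  by rewrite -[X in (X <= _)%N]coset_order.
have : coset H g \in <[coset H a]>%g by rewrite -cGH mem_quotient.
move=> /cyclePmin[i]; rewrite coset_order => ip e.
exists (Ordinal ip); rewrite /= coset_idr //.
  by rewrite groupM ?groupV ?groupX ?ext_norm.
by rewrite morphM ?morphV ?morphX ?groupV ?groupX ?ext_norm //= e mulgV.
Qed.
End PrimeExtension.

(* The induced module V (x)_{FH} FG.  Since FG is free as a left FH-module on *)
(* 1, a, ..., a^(p-1), it is the direct sum of the V (x) a^i: its elements    *)
(* are rows of p blocks, the i-th of which is the component w_i of            *)
(* sum_i w_i (x) a^i.  If g a^-k is in H then v (x) g = v(g a^-k) (x) a^k;    *)
(* this defines tens v g.  Lemma tens_universal is the universal property of  *)
(* the tensor product (a balanced map on V x FG amounts to a family of linear *)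
(* maps on V indexed by G), and tens_induced gives the action of G.           *)
Section Induced.
Variables (F : fieldType) (gT : finGroupType) (G H : {group gT}) (p : nat).
Variables (a : gT) (ext : prime_extension G H p a) (n : nat).
Variable sigma : mx_representation F H n.

Definition sigma_ext (g : gT) : 'M[F]_n := if g \in H then sigma g else 0.

Definition induced_dim : nat := (\sum_(i < p) n)%N.

Definition tens (v : 'rV[F]_n) (g : gT) : 'rV[F]_induced_dim :=
  \mxrow_(k < p) (v *m sigma_ext (g * (a ^+ k)^-1)%g).

Definition induced_mx (g : gT) : 'M[F]_induced_dim :=
  \mxblock_(i < p, j < p) sigma_ext (a ^+ i * g * (a ^+ j)^-1)%g.

Lemma sigma_extMl h g : h \in H -> sigma_ext (h * g)%g = sigma h *m sigma_ext g.
Proof.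
move=> Hh; rewrite /sigma_ext groupMl //; case: ifP => [Hg|]; last by rewrite mulmx0.
exact: repr_mxM.
Qed.

Lemma tensD g u v : tens (u + v) g = tens u g + tens v g.
Proof.
apply/rowP=> j; rewrite !mxE -big_split /=.
by apply: eq_bigr => k _; rewrite mxE mulrDl.
Qed.
Lemma tensZ g c v : tens (c *: v) g = c *: tens v g.
Proof.
apply/rowP=> j; rewrite !mxE big_distrr /=.
by apply: eq_bigr => k _; rewrite mxE mulrA.
Qed.

Lemma tens_balanced v h g : h \in H -> tens (v *m sigma h) g = tens v (h * g)%g.
Proof.
move=> Hh; apply/mxrowP=> k; rewrite !mxrowK -mulgA.
by rewrite [in RHS]sigma_extMl ?mulmxA.
Qed.

Lemma tens_exp v (i : 'I_p) k :
  submxrow (tens v (a ^+ i)%g) k = if i == k then v else 0.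
Proof.
rewrite mxrowK /sigma_ext (memH_exp_mul ext).
by case: eqP => [->|_]; rewrite ?mulgV ?repr_mx1 ?mulmx1 ?mulmx0.
Qed.

Lemma tens_sum w : w = \sum_(i < p) tens (submxrow w i) (a ^+ i)%g.
Proof.
apply/mxrowP=> k.
have -> : submxrow (\sum_(i < p) tens (submxrow w i) (a ^+ i)%g) k =
    \sum_(i < p) submxrow (tens (submxrow w i) (a ^+ i)%g) k.
  by apply/matrixP=> r s; rewrite mxE !summxE; apply: eq_bigr => i _; rewrite !mxE.
rewrite (bigD1 k) //= tens_exp eqxx big1 ?addr0 //.
by move=> i /negPf ik; rewrite tens_exp ik.
Qed.

Lemma tens_induced v g g' : g \in G ->
  tens v g *m induced_mx g' = tens v (g * g')%g.
Proof.
move=> Gg; rewrite /tens mul_mxrow_mxblock; apply/eq_mxrowP=> j.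
have [i Hi] := transversal ext Gg.
rewrite (bigD1 i) //= big1 ?addr0 => [|k ki].
  rewrite {1}/sigma_ext Hi -mulmxA -sigma_extMl // !mulgA; congr (_ *m sigma_ext _).
  by rewrite mulgKV.
rewrite {1}/sigma_ext; case: ifP => [Hk|]; last by rewrite mulmx0 mul0mx.
case/eqP: ki; apply/eqP; rewrite -(memH_exp_mul ext).
by rewrite -groupV invMg invgK -(groupMl _ Hi) mulgA mulgKV.
Qed.

Lemma induced_mx_repr : mx_repr G induced_mx.
Proof.
have tens_ind (A B : 'M[F]_induced_dim) :
  (forall i v, tens v (a ^+ i)%g *m A = tens v (a ^+ i)%g *m B) -> A = B.
  move=> AB; apply/row_matrixP=> r; rewrite !rowE (tens_sum (delta_mx 0 r)).
  by rewrite !mulmx_suml; apply: eq_bigr.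
have Ga i : (a ^+ i)%g \in G by rewrite groupX ?(ext_inG ext).
split=> [|x y Gx Gy]; apply: tens_ind => i v.
  by rewrite tens_induced // mulg1 mulmx1.
by rewrite mulmxA !tens_induced ?groupM // mulgA.
Qed.
Definition induced_repr : mx_representation F G induced_dim :=
  MxRepresentation induced_mx_repr.

Lemma tens_universal (W : lmodType F) (b : 'rV[F]_n -> gT -> W) :
    (forall g, linear (b ^~ g)) ->
    (forall v h g, h \in H -> g \in G -> b (v *m sigma h) g = b v (h * g)%g) ->
  exists f : {linear 'rV[F]_induced_dim -> W},
    (forall v g, g \in G -> f (tens v g) = b v g) /\
    (forall f' : {linear 'rV[F]_induced_dim -> W},
      (forall v g, g \in G -> f' (tens v g) = b v g) -> f' =1 f).
Proof.
move=> b_lin b_bal.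
pose f0 w := \sum_(i < p) b (submxrow w i) (a ^+ i)%g.
have f0_lin : linear f0.
  move=> c u v; rewrite /f0 scaler_sumr -big_split; apply: eq_bigr => i _ /=.
  rewrite -b_lin; congr (b _ _).
  by apply/matrixP=> r s; rewrite !mxE.
pose f1 := GRing.isLinear.Build F _ W _ f0 f0_lin.
pose f : {linear 'rV[F]_induced_dim -> W} := HB.pack f0 f1.
have b0 g : b 0 g = 0.
  by have := b_lin g 1 0 0; rewrite !scale1r addr0 -{1}[b 0 g]addr0 => /addrI.
exists f; split=> [v g Gg | f' f'E].
  rewrite /= /f0; have [i Hi] := transversal ext Gg.
  rewrite (bigD1 i) //= big1 ?addr0 => [|k ki].
    rewrite mxrowK /sigma_ext Hi b_bal ?mulgKV //.
    by rewrite groupX ?(ext_inG ext).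
  rewrite mxrowK /sigma_ext; case: ifP => [Hk|]; last by rewrite mulmx0 b0.
  case/eqP: ki; apply/eqP; rewrite -(memH_exp_mul ext).
  by rewrite -groupV invMg invgK -(groupMl _ Hi) mulgA mulgKV.
move=> w; rewrite /= /f0 [in LHS](tens_sum w) linear_sum; apply: eq_bigr => i _.
by rewrite f'E // groupX ?(ext_inG ext).
Qed.
End Induced.

Section Twist.
Variables (F : fieldType) (gT : finGroupType) (G H : {group gT}) (p : nat).
Variables (a : gT) (ext : prime_extension G H p a) (d : nat).
Variables (sigma : mx_representation F H d.+1) (alpha : 'M[F]_d.+1).
Variable tw : twisting a sigma alpha.

Lemma twist_centgmx (delta : endo sigma) :
  centgmx sigma (alpha^-1 * delta * alpha).
Proof.
have aU := twist_unit tw; apply/centgmxP=> h Hh.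
have Hh' : (a * h * a^-1)%g \in H.
  have: (h ^ a^-1)%g \in H by rewrite memJ_norm ?groupV ?(ext_norm ext).
  by rewrite conjgE invgK mulgA.
have e : alpha * sigma h = sigma (a * h * a^-1)%g * alpha.
  by rewrite (twistE tw) // mulrVK.
have /centgmxP/(_ _ Hh') cd := endoP delta.
rewrite -![_ *m _]/(_ * _) in cd *.
apply: (mulrI aU); rewrite -!mulrA e !mulrA mulrV // mul1r cd.
by rewrite e mulrK.
Qed.
Definition twist (delta : endo sigma) : endo sigma := Endo (twist_centgmx delta).

Lemma twist_is_zmod : zmod_morphism twist.
Proof. by move=> x y; apply: val_inj; rewrite /= mulrBr mulrBl. Qed.
Lemma twist_is_monoid : monoid_morphism twist.
Proof.
have aU := twist_unit tw; split=> [|x y]; apply: val_inj => /=.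
  by rewrite mulr1 mulVr.
by rewrite !mulrA mulrK // -!mulrA.
Qed.
HB.instance Definition _ :=
  GRing.isZmodMorphism.Build (endo sigma) (endo sigma) twist twist_is_zmod.
HB.instance Definition _ :=
  GRing.isMonoidMorphism.Build (endo sigma) (endo sigma) twist twist_is_monoid.

Lemma iter_twist i delta :
  iter i twist delta = alpha ^- i * delta * alpha ^+ i :> 'M_d.+1.
Proof.
elim: i => [|i IH]; first by rewrite invr1 mul1r mulr1.
rewrite iterS /= IH -!exprVn [alpha^-1 ^+ i.+1]exprS.
by rewrite [alpha ^+ i.+1]exprSr !mulrA.
Qed.

Lemma twist_exp i h : h \in H ->
  sigma (a ^+ i * h * (a ^+ i)^-1)%g = alpha ^+ i * sigma h * alpha ^- i.
Proof.
move=> Hh; have aN := ext_norm ext.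
elim: i => [|i IH]; first by rewrite expg0 invg1 mulg1 mul1g invr1 mulr1 mul1r.
have -> : (a ^+ i.+1 * h * (a ^+ i.+1)^-1 = a * (a ^+ i * h * (a ^+ i)^-1) * a^-1)%g.
  by rewrite expgS invMg !mulgA.
rewrite (twistE tw) ?IH; last first.
  have: (h ^ (a ^+ i)^-1)%g \in H by rewrite memJ_norm ?groupV ?groupX.
  by rewrite conjgE invgK mulgA.
by rewrite -!exprVn [alpha ^+ i.+1]exprS [alpha^-1 ^+ i.+1]exprSr !mulrA.
Qed.

Lemma lambda_centgmx : centgmx sigma (alpha ^- p * sigma (a ^+ p)%g).
Proof.
have aU := twist_unit tw; have Hp := mem_apH ext.
apply/centgmxP=> h Hh; rewrite -![_ *m _]/(_ * _).
have apU : alpha ^+ p \is a GRing.unit by rewrite unitrX.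
apply: (mulrI apU); rewrite !mulrA mulrV // mul1r -twist_exp //.
by rewrite -![_ * _]/(_ *m _) -!repr_mxM ?groupM ?groupV ?mulgKV.
Qed.
Definition lambda : endo sigma := Endo lambda_centgmx.

Lemma lambda_unit : lambda \is a GRing.unit.
Proof.
have aU := twist_unit tw.
suff: (alpha ^- p * sigma (a ^+ p)%g : 'M_d.+1) \is a GRing.unit by [].
rewrite unitrMl ?unitrV ?unitrX //.
exact: (repr_mx_unit sigma (mem_apH ext)).
Qed.

Lemma lambda_fix : twist lambda = lambda.
Proof.
have aU := twist_unit tw; apply: val_inj => /=.
have Hp := mem_apH ext.
have e : sigma (a ^+ p)%g * alpha = alpha * sigma (a ^+ p)%g.
  have := twistE tw Hp; rewrite -expgS expgSr mulgK => {1}->.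
  by rewrite mulrVK.
rewrite -!mulrA e !mulrA; congr (_ * _).
by rewrite -exprVn -exprS exprSr mulrVK.
Qed.

Lemma lambda_inner delta : iter p twist delta = lambda * delta * lambda^-1.
Proof.
apply: (mulIr lambda_unit); rewrite divrK ?lambda_unit //.
apply: val_inj; rewrite /= iter_twist.
have aU := twist_unit tw; have apU : alpha ^+ p \is a GRing.unit by rewrite unitrX.
have /centgmxP/(_ _ (mem_apH ext)) := endoP delta.
rewrite -![_ *m _]/(_ * _) => cd.
by rewrite !mulrA mulrK // -!mulrA cd.
Qed.

Definition lambda_datum : cyclic_datum twist lambda p :=
  CyclicDatum lambda_unit lambda_fix lambda_inner.

Local Notation Vup := (induced_dim p d.+1).
(* D(delta) and X: matrices relative to induced_basis, not to the standard    *)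
(* basis of the rows of blocks.                                               *)
Definition block_diag (delta : endo sigma) : 'M[F]_Vup :=
  \mxdiag_(i < p) (iter i twist delta : 'M[F]_d.+1).

Definition block_shift : 'M[F]_Vup :=
  \mxblock_(i < p, j < p)
     if j == i.+1 :> nat then 1
     else if (i == p.-1 :> nat) && (j == 0 :> nat) then lambda : 'M[F]_d.+1
     else 0.

(* The rows are the e_j alpha^-i a^i, in the order i = 0, ..., p - 1.         *)
Definition induced_basis : 'M[F]_Vup :=
  \mxcol_(i < p) \matrix_(j < d.+1)
     tens p a sigma (delta_mx 0 j *m alpha ^- i) (a ^+ i)%g.

Definition induced_sum (beta : 'I_p -> 'M[F]_d.+1) (v : 'rV[F]_d.+1) :
    'rV[F]_Vup :=
  \sum_(i < p) tens p a sigma (v *m beta i) (a ^+ i)%g.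

Definition U_coef (mu : endo sigma) (i : 'I_p) : 'M[F]_d.+1 :=
  endo_mx (left_pow twist mu i) * alpha ^- i.

(* The rows are the e'_j = e_j sum_i mu^[i] alpha^-i a^i.                     *)
Definition U_basis (mu : endo sigma) : 'M[F]_(d.+1, Vup) :=
  \matrix_(j < d.+1)
     induced_sum (U_coef mu) (delta_mx 0 j).

(* U(mu) as a row space; see U_spaceP.                                        *)
Definition U_space (mu : endo sigma) : 'M[F]_Vup := <<U_basis mu>>%MS.

Lemma U_basisE mu v : v *m U_basis mu =
  induced_sum (U_coef mu) v.
Proof.
have e (beta : 'I_p -> 'M[F]_d.+1) : linear (induced_sum beta).
  move=> c u w; rewrite /induced_sum scaler_sumr -big_split /=.
  by apply: eq_bigr => i _; rewrite mulmxDl -scalemxAl tensD tensZ.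
set beta := U_coef mu.
pose f : {linear _ -> _} := HB.pack (induced_sum beta)
   (GRing.isLinear.Build F _ _ _ _ (e beta)).
rewrite -[RHS]/(f v) {2}(row_sum_delta v) linear_sum mulmx_sum_row.
by apply: eq_bigr => j _; rewrite linearZ rowK.
Qed.

Lemma U_spaceP mu w : reflect
  (exists v, w = induced_sum (U_coef mu) v)
  (w <= U_space mu)%MS.
Proof.
rewrite genmxE; apply: (iffP submxP) => -[v ->]; exists v; rewrite ?U_basisE //.
Qed.

Lemma induced_basis_unit : induced_basis \in unitmx.
Proof.
have -> : induced_basis = \mxdiag_(i < p) (alpha ^- i : 'M[F]_d.+1).
  apply/mxcolP=> i; rewrite mxcolK; apply/row_matrixP=> j; rewrite rowK.
  apply/mxrowP=> k; rewrite (tens_exp ext).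
  transitivity (row j (submxblock (\mxdiag_(i < p) (alpha ^- i : 'M[F]_d.+1)) i k)).
    rewrite mxblockK; have [->|_] := eqVneq i k; last by rewrite row0.
    by rewrite conform_mx_id rowE.
  by apply/matrixP=> r s; rewrite !mxE.
have aU := twist_unit tw.
suff: \mxdiag_(i < p) (alpha ^- i : 'M[F]_d.+1) *m
      \mxdiag_(i < p) (alpha ^+ i : 'M[F]_d.+1) = 1%:M by case/mulmx1_unit.
rewrite mul_mxblock_mxdiag -mxdiagZ; apply/eq_mxblock => i j.
case: eqVneq => [->|_]; last by rewrite mul0mx.
rewrite !conform_mx_id -[RHS](@mulVr _ (alpha ^+ j)) ?unitrX //.
Qed.
End Twist.

(* rho is the representation afforded, relative to the basis formed by the    *)
(* rows of E, by the submodule that they span.                                *)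
Definition afforded_by (F : fieldType) (gT : finGroupType) (G : {group gT})
    (N m : nat) (rG : mx_representation F G N) (E : 'M[F]_(m, N))
    (rho : mx_representation F G m) : Prop :=
  row_free E /\ forall g, g \in G -> E *m rG g = rho g *m E.

(* Main.v *)
(* Put B_n = alpha^-n a^n, viewed as a map V -> V^ (V^ the induced module).  It
   commutes with H, satisfies B_n a = alpha B_(n+1) and B_(n+p) = lambda B_n, and
   every FH-map V -> V^ is uniquely sum_(i < p) delta_i B_i with delta_i in
   Delta.  By Frobenius reciprocity restriction to V identifies End_FG(V^) with
   these sums, hence with the cyclic algebra.  Let W be a simple submodule.  As
   alpha has order p on the centre of Delta, the cyclic algebra is simple, so V^
   is a direct sum of copies of W; restricting to H, the rank of W is a multiple
   of d, and p being prime, W is V^ or has rank d.  In the latter case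
   W = V(sum_i e_i B_i), and stability under a gives e_i = e_0 mu^[i] with
   mu^[p] = lambda^-1, that is W = U(mu). *)

From HB Require Import structures.
Require Import Defs.
From mathcomp Require Import all_boot all_order all_algebra.
From mathcomp Require Import all_fingroup mxrepresentation.
From mathcomp Require Import generic_quotient ring_quotient.
From mathcomp Require Import boolp.

Set Implicit Arguments.
Unset Strict Implicit.
Unset Printing Implicit Defensive.

Import GRing.Theory.
Local Open Scope ring_scope.

(** Cyclic reindexing: the term entering at the top of the range replaces the one leaving at the
    bottom. It absorbs the shift of the blocks caused by [a]. *)
Lemma sum_wrap (W : zmodType) (f : nat -> W) n : f n = f 0%N ->
  \sum_(i < n) f i.+1 = \sum_(i < n) f i.
Proof.
move=> fn; have : \sum_(i < n.+1) f i = \sum_(i < n.+1) f i by [].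
by rewrite {1}big_ord_recl big_ord_recr /= fn addrC => /addrI.
Qed.

(** * The universal property of the cyclic algebra *)

Section CyclicAlgebraUniversal.
Variables (D : unitRingType) (alpha : {rmorphism D -> D}) (lam : D) (p : nat).
Variable dat : cyclic_datum alpha lam p.

(** The relation $x^p=\lambda$ reduces exponents modulo [p]. Only existence of the coefficients is
    claimed; in [cyclic_alg_endo] their uniqueness comes from [comb_free]. *)
Lemma cyclic_alg_span (z : cyclic_alg dat) : (0 < p)%N ->
  exists delta : 'I_p -> D, z = \sum_(i < p) cyclicC dat (delta i) * cyclicX dat ^+ i.
Proof.
move=> p_gt0.
pose span (y : cyclic_alg dat) := exists delta : 'I_p -> D,
  y = \sum_(i < p) cyclicC dat (delta i) * cyclicX dat ^+ i.
pose piM := rmorphM (cyclic_pi dat).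
pose piX := rmorphXn (cyclic_pi dat).
have piT k : cyclic_pi dat (skewT alpha ^+ k) = cyclicX dat ^+ k by exact: piX.
have Xp : cyclicX dat ^+ p = cyclicC dat lam.
  rewrite -piT; apply/cyclic_pi_eq/cyclic_idealP.
  by exists 1; rewrite mulr1.
have spanM c n : span (cyclicC dat c * cyclicX dat ^+ n).
  exists (fun i => if i == (n %% p)%N :> nat then c * lam ^+ (n %/ p)%N else 0).
  have np : (n %% p < p)%N by rewrite ltn_mod.
  rewrite (bigD1 (Ordinal np)) //= eqxx [X in _ + X]big1 ?addr0 => [|i]; last first.
    by rewrite -val_eqE => /negPf /= ->; rewrite /cyclicC !rmorph0 mul0r.
  rewrite {1}(divn_eq n p) exprD mulnC exprM Xp mulrA; congr (_ * _).
  by rewrite /cyclicC -!rmorphXn -!rmorphM.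
have spanD y y' : span y -> span y' -> span (y + y').
  move=> [e ->] [e' ->]; exists (fun i => e i + e' i).
  rewrite -big_split; apply: eq_bigr => i _ /=.
  by rewrite -mulrDl /cyclicC !rmorphD.
have span0 : span 0.
  exists (fun=> 0); rewrite big1 // => i _.
  by rewrite /cyclicC !rmorph0 mul0r.
suff : span (cyclic_pi dat (repr z)) by rewrite [cyclic_pi _ _]reprK.
rewrite [repr z]skewE rmorph_sum; apply: (big_ind span) => // i _.
rewrite [X in span X](_ : _ = cyclicC dat (repr z : {poly D})`_i * cyclicX dat ^+ i) //.
by rewrite -piT; exact: piM.
Qed.

Variables (E : pzRingType) (phi : {rmorphism D -> E}) (x : E).
Hypothesis x_phi : forall delta, x * phi delta = phi (alpha delta) * x.

Definition skew_eval (f : skew_poly alpha) : E :=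
  \sum_(i < size (f : {poly D})) phi (f : {poly D})`_i * x ^+ i.

Lemma skew_eval_widen n (f : skew_poly alpha) : (size (f : {poly D}) <= n)%N ->
  skew_eval f = \sum_(i < n) phi (f : {poly D})`_i * x ^+ i.
Proof.
move=> le_fn; rewrite /skew_eval (big_ord_widen _ (fun i => phi (f : {poly D})`_i * x ^+ i) le_fn).
rewrite big_mkcond; apply: eq_bigr => i _; case: ltnP => // le_fi.
by rewrite nth_default // rmorph0 mul0r.
Qed.

Lemma skew_eval_is_zmod : zmod_morphism skew_eval.
Proof.
move=> f g; pose n := maxn (size (f - g : {poly D}))
  (maxn (size (f : {poly D})) (size (g : {poly D}))).
rewrite !(@skew_eval_widen n) ?leq_max ?leqnn ?orbT // -sumrB.
by apply: eq_bigr => i _; rewrite coefB rmorphB mulrBl.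
Qed.
HB.instance Definition _ :=
  GRing.isZmodMorphism.Build (skew_poly alpha) E skew_eval skew_eval_is_zmod.

Lemma skew_eval_monomial delta n :
  skew_eval (skewC alpha delta * skewT alpha ^+ n) = phi delta * x ^+ n.
Proof.
set f := _ * _; pose m := maxn (size (f : {poly D})) n.+1.
have nm : (n < m)%N by rewrite leq_max leqnn orbT.
rewrite (@skew_eval_widen m) ?leq_max ?leqnn // (bigD1 (Ordinal nm)) //=.
rewrite skewCT_coef eqxx big1 ?addr0 // => i.
by rewrite skewCT_coef -val_eqE => /negPf /= ->; rewrite rmorph0 mul0r.
Qed.

(** By additivity only products of monomials matter, and moving $t^i$ or $x^i$ past a coefficient
    applies $\alpha^i$ in both rings alike. *)
Lemma skew_eval_is_monoid : monoid_morphism skew_eval.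
Proof.
have xn_phi n delta : x ^+ n * phi delta = phi (iter n alpha delta) * x ^+ n.
  elim: n delta => [|n IH] delta; first by rewrite !expr0 mulr1 mul1r.
  by rewrite exprSr -mulrA x_phi mulrA IH -mulrA -iterSr.
split=> [|f g].
  by have := skew_eval_monomial 1 0; rewrite !expr0 !mulr1 !rmorph1.
rewrite [f in LHS]skewE [g in LHS]skewE mulr_suml raddf_sum mulr_suml.
apply: eq_bigr => i _; rewrite mulr_sumr raddf_sum mulr_sumr.
apply: eq_bigr => j _.
transitivity (skew_eval (skewC alpha ((f : {poly D})`_i *
    iter i alpha (g : {poly D})`_j) * skewT alpha ^+ (i + j))).
  congr skew_eval; rewrite rmorphM exprD -!mulrA; congr (_ * _).
  by rewrite !mulrA skewTnC.
rewrite !skew_eval_monomial rmorphM exprD -!mulrA; congr (_ * _).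
by rewrite !mulrA xn_phi.
Qed.
HB.instance Definition _ :=
  GRing.isMonoidMorphism.Build (skew_poly alpha) E skew_eval skew_eval_is_monoid.

Hypothesis x_lam : x ^+ p = phi lam.

Definition cyclic_eval (z : cyclic_alg dat) : E := skew_eval (repr z).

(** Two representatives of a class differ by a right multiple of $t^p-\lambda$, which [x_lam] sends
    to 0; so the choice made by [repr] does not matter. *)
Lemma cyclic_eval_pi f : cyclic_eval (cyclic_pi dat f) = skew_eval f.
Proof.
have /cyclic_pi_eq/cyclic_idealP[g e] :
    cyclic_pi dat (repr (cyclic_pi dat f)) = cyclic_pi dat f.
  by rewrite [LHS]reprK.
rewrite /cyclic_eval; have /(canRL (subrK _)) -> := e.
suff c0 : skew_eval (skewT alpha ^+ p - skewC alpha lam) = 0.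
  by rewrite rmorphD rmorphM /= c0 mul0r add0r.
rewrite rmorphB /=.
have := skew_eval_monomial 1 p; rewrite [skewC _ _]rmorph1 !mul1r => ->.
have := skew_eval_monomial lam 0; rewrite !expr0 !mulr1 => ->.
by rewrite rmorph1 mul1r x_lam subrr.
Qed.

Lemma cyclic_eval_is_zmod : zmod_morphism cyclic_eval.
Proof.
move=> y z; rewrite -[y]reprK -[z]reprK.
rewrite -![\pi_(_)%qT (repr _)]/(cyclic_pi dat (repr _)) -raddfB !cyclic_eval_pi.
exact: raddfB.
Qed.
Lemma cyclic_eval_is_monoid : monoid_morphism cyclic_eval.
Proof.
split=> [|y z].
  by rewrite -(rmorph1 (cyclic_pi dat)) cyclic_eval_pi rmorph1.
rewrite -[y]reprK -[z]reprK.
rewrite -![\pi_(_)%qT (repr _)]/(cyclic_pi dat (repr _)) -rmorphM !cyclic_eval_pi.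
exact: rmorphM.
Qed.

Lemma cyclic_alg_lift : exists f : {rmorphism cyclic_alg dat -> E},
  (forall delta, f (cyclicC dat delta) = phi delta) /\ f (cyclicX dat) = x.
Proof.
pose f : {rmorphism cyclic_alg dat -> E} := HB.pack cyclic_eval
  (GRing.isZmodMorphism.Build _ _ _ cyclic_eval_is_zmod)
  (GRing.isMonoidMorphism.Build _ _ _ cyclic_eval_is_monoid).
exists f; split=> [delta|] /=.
  have := skew_eval_monomial delta 0; rewrite !expr0 !mulr1 => <-.
  exact: cyclic_eval_pi.
have := skew_eval_monomial 1 1; rewrite !rmorph1 !mul1r !expr1 => <-.
exact: cyclic_eval_pi.
Qed.
End CyclicAlgebraUniversal.

(** * Submodules affording a given representation *)

Section Afforded.
Variables (F : fieldType) (gT : finGroupType) (G : {group gT}) (m n : nat).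
Variables (rG : mx_representation F G n) (rho : mx_representation F G m).
Implicit Types E : 'M[F]_(m, n).

(** [mxsimple_exists] concludes only under the [classically] modality; aiming it at the boolean
    [asbool] of the goal removes that modality. *)
Lemma mxsimple_sub_exists (U : 'M[F]_n) : mxmodule rG U -> U != 0 ->
  exists2 W : 'M[F]_n, mxsimple rG W & (W <= U)%MS.
Proof.
move=> modU nzU; apply/asboolP; apply: (mxsimple_exists modU nzU).
exact: asboolT.
Qed.

(** [pinvmx E] is a right inverse of [E] because the rows are free, so [r g] is the coordinate
    matrix of the action of [g]. *)
Lemma afforded_exists E : row_free E -> mxmodule rG E ->
  exists rho', afforded_by rG E rho'.
Proof.
move=> freeE /mxmoduleP modE.
pose r g := E *m rG g *m pinvmx E.
have rE g : g \in G -> r g *m E = E *m rG g.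
  by move=> Gg; rewrite mulmxKpV ?modE.
have r_repr : mx_repr G r.
  split=> [|x y Gx Gy]; first by rewrite /r repr_mx1 mulmx1 mulmxVp.
  apply: (row_free_inj freeE); rewrite rE ?groupM // -[RHS]mulmxA rE //.
  by rewrite [RHS]mulmxA rE // repr_mxM // mulmxA.
by exists (MxRepresentation r_repr); split=> // g Gg; rewrite rE.
Qed.

Lemma afforded_rank E : afforded_by rG E rho -> \rank <<E>>%MS = m.
Proof. by case=> /eqP freeE _; rewrite genmxE. Qed.

Lemma afforded_module E : afforded_by rG E rho -> mxmodule rG <<E>>%MS.
Proof.
case=> _ EJ; rewrite (eqmx_module _ (genmxE E)).
by apply/mxmoduleP=> g Gg; rewrite EJ // submxMl.
Qed.

(** [E] embeds the module of [rho]: a submodule of the image is [A *m E], and the row space of [A]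
    is stable under [rho], hence everything. *)
Lemma afforded_simple E : mx_irreducible rho -> afforded_by rG E rho ->
  mxsimple rG <<E>>%MS.
Proof.
move=> /mx_irrP[m_gt0 irr] aff; have [freeE EJ] := aff.
split; first exact: afforded_module aff.
  by rewrite -mxrank_eq0 (afforded_rank aff) -lt0n.
move=> U /mxmoduleP modU; rewrite genmxE => /submxP[A UE] nzU.
have modA : mxmodule rho <<A>>%MS.
  rewrite (eqmx_module _ (genmxE A)); apply/mxmoduleP=> g Gg.
  by rewrite -(submxMfree _ _ freeE) -mulmxA -EJ // mulmxA -UE modU.
rewrite genmxE UE -{1}[E]mul1mx submxMr //.
suff: row_full <<A>>%MS by rewrite -sub1mx genmxE.
apply: irr modA _; rewrite -mxrank_eq0 genmxE mxrank_eq0.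
by apply: contraNneq nzU => A0; rewrite UE A0 mul0mx.
Qed.

Lemma afforded_iso E E' : mx_irreducible rho ->
  afforded_by rG E rho -> afforded_by rG E' rho -> mx_iso rG <<E>>%MS <<E'>>%MS.
Proof.
move=> irr aff aff'; have [freeE EJ] := aff; have [freeE' EJ'] := aff'.
have EE' : E *m (pinvmx E *m E') = E' by rewrite mulmxA mulmxVp // mul1mx.
have e : (<<E>> *m (pinvmx E *m E') :=: <<E'>>)%MS.
  apply: eqmx_trans (eqmxMr _ (genmxE E)) _; rewrite EE'.
  exact/eqmx_sym/genmxE.
apply: (@mx_Schur_iso _ _ _ _ _ _ _ (pinvmx E *m E')).
- exact: afforded_simple aff.
- exact: afforded_simple aff'.
- rewrite genmxE; apply/hom_mxP=> g Gg.
  by rewrite EJ // -mulmxA EE' EJ'.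
- by rewrite e.
- by have [_ nz _] := afforded_simple irr aff'; rewrite (eqmx_eq0 e).
Qed.

Lemma iso_afforded E M : afforded_by rG E rho -> mx_iso rG <<E>>%MS M ->
  exists2 E', afforded_by rG E' rho & (E' :=: M)%MS.
Proof.
move=> [freeE EJ] [f fU]; rewrite genmxE => /hom_mxP homE eM.
exists (E *m f).
  split=> [|g Gg]; last by rewrite -homE // EJ // mulmxA.
  by rewrite /row_free mxrankMfree ?row_free_unit.
by apply: eqmx_trans eM; apply/eqmx_sym/eqmxMr/genmxE.
Qed.

Lemma afforded_rsim E (U : 'M[F]_n) (modU : mxmodule rG U) :
  afforded_by rG E rho -> (U :=: E)%MS -> mx_rsim (submod_repr modU) rho.
Proof.
move=> [/eqP freeE EJ] UE; apply: mx_rsim_sym.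
have sEU : (E <= U)%MS by rewrite UE.
exists (in_submod U E); first by rewrite UE freeE.
  by rewrite /row_free mxrank_in_submod // freeE.
move=> g Gg; rewrite -[submod_repr modU g]/(submod_mx modU g) -in_submodJ // EJ //.
by rewrite [in RHS]in_submodE [in LHS]in_submodE mulmxA.
Qed.
End Afforded.

(** * The induced module *)

Section Induced.
Variables (F : fieldType) (gT : finGroupType) (G H : {group gT}) (p : nat).
Variables (a : gT) (ext : prime_extension G H p a) (d : nat).
Variables (sigma : mx_representation F H d.+1) (alpha : 'M[F]_d.+1).
Variable tw : twisting a sigma alpha.

Local Notation N := (induced_dim p d.+1).
Local Notation Vup := (induced_repr ext sigma).
Local Notation Delta := (endo sigma).
Local Notation tau := (twist ext tw).
Local Notation lam := (lambda ext tw).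
Let Ga : a \in G := ext_inG ext.
Let sHG : H \subset G := ext_sub ext.
Let aU : alpha \is a GRing.unit := twist_unit tw.
Let p_gt0 : (0 < p)%N := prime_gt0 (ext_prime ext).

Definition tens_mx (g : gT) : 'M[F]_(d.+1, N) :=
  \mxrow_(k < p) sigma_ext sigma (g * (a ^+ k)^-1)%g.

Lemma mul_tens_mx v g : v *m tens_mx g = tens p a sigma v g.
Proof. exact: mul_mxrow. Qed.

Lemma tens_mxJ g g' : g \in G -> tens_mx g *m Vup g' = tens_mx (g * g')%g.
Proof.
move=> Gg; apply/row_matrixP=> i.
by rewrite !rowE mulmxA !mul_tens_mx (tens_induced ext).
Qed.

Lemma tens_mx_balanced h g : h \in H -> tens_mx (h * g)%g = sigma h *m tens_mx g.
Proof.
move=> Hh; rewrite /tens_mx mul_mxrow; apply: eq_mxrow => k.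
by rewrite -mulgA sigma_extMl.
Qed.

(* The rows of [tblock i] for [i < p] are the e_j alpha^-i a^i; letting the
   index run over all naturals makes the action of a uniform, the wrap-around
   being absorbed by [tblock_p]. *)
Definition tblock n : 'M[F]_(d.+1, N) := alpha ^- n *m tens_mx (a ^+ n)%g.

Lemma alphaXU n : alpha ^+ n \is a GRing.unit.
Proof. by rewrite unitrX. Qed.

(** Pulling [h] to the left across [a ^+ n] conjugates it, which [sigma] turns into conjugation by
    [alpha ^+ n]; the factor [alpha ^- n] of the block undoes exactly this. *)
Lemma tblockH n h : h \in H -> tblock n *m Vup h = sigma h *m tblock n.
Proof.
move=> Hh; rewrite /tblock -mulmxA tens_mxJ ?groupX //.
have -> : (a ^+ n * h = (a ^+ n * h * (a ^+ n)^-1) * a ^+ n)%g by rewrite mulgKV.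
have nHa := ext_norm ext.
rewrite tens_mx_balanced; last first.
  have : (h ^ (a ^+ n)^-1)%g \in H by rewrite memJ_norm ?groupV ?groupX.
  by rewrite conjgE invgK mulgA.
rewrite (twist_exp ext tw) // !mulmxA; congr (_ *m _).
rewrite -![_ *m _]/(_ * _).
by rewrite mulVr ?alphaXU // mul1r.
Qed.

Lemma tblock_a n : tblock n *m Vup a = alpha *m tblock n.+1.
Proof.
rewrite /tblock -mulmxA tens_mxJ ?groupX // -expgSr mulmxA; congr (_ *m _).
by rewrite -[RHS]/(_ * _) -!exprVn exprS mulrA mulrV // mul1r.
Qed.

Lemma tblock_aX n k : tblock n *m Vup (a ^+ k)%g = alpha ^+ k *m tblock (n + k).
Proof.
elim: k => [|k IH].
  by rewrite expg0 repr_mx1 mulmx1 expr0 addn0 [RHS]mul1mx.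
rewrite expgSr repr_mxM ?groupX // mulmxA IH -mulmxA tblock_a mulmxA addnS.
by rewrite [in RHS]exprSr.
Qed.

Lemma twistJ (delta : Delta) :
  alpha *m endo_mx (tau delta) = endo_mx delta *m alpha.
Proof. by rewrite -![_ *m _]/(_ * _) /= !mulrA mulrV // mul1r. Qed.

Lemma alphaX_lam n :
  alpha ^+ n *m endo_mx lam = endo_mx lam *m alpha ^+ n.
Proof.
have c : GRing.comm (endo_mx lam : 'M_d.+1) alpha.
  by have := twistJ lam; rewrite (lambda_fix ext tw) => /esym.
exact/esym/(commrX n c).
Qed.

(** In $a^{n+p}=a^pa^n$ the factor $a^p$ lies in $H$ and crosses the tensor sign; together with
    $\alpha^{-p}$ it gives $\lambda$, which commutes with $\alpha$. *)
Lemma tblock_p n : tblock (n + p) = endo_mx lam *m tblock n.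
Proof.
rewrite /tblock addnC expgD tens_mx_balanced ?(mem_apH ext) // !mulmxA.
congr (_ *m _); apply: (mulrI (alphaXU n)).
rewrite -[RHS]/(alpha ^+ n *m (endo_mx lam *m alpha ^- n)).
rewrite [RHS]mulmxA alphaX_lam -[RHS]mulmxA -![_ *m _]/(_ * _).
rewrite [in RHS]mulrV ?alphaXU // mulr1 mulrA; congr (_ * _).
by rewrite -!exprVn addnC exprD !exprVn mulrA mulrV ?alphaXU // mul1r.
Qed.

Lemma induced_basisE : induced_basis p a sigma alpha = \mxcol_(i < p) tblock i.
Proof.
apply: eq_mxcol => i; apply/row_matrixP=> j.
by rewrite rowK rowE mulmxA mul_tens_mx.
Qed.

Lemma mul_mxrow_tblock m (A : 'I_p -> 'M[F]_(m, d.+1)) :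
  \mxrow_i A i *m induced_basis p a sigma alpha = \sum_(i < p) A i *m tblock i.
Proof. by rewrite induced_basisE mul_mxrow_mxcol. Qed.

Lemma tblock_ext m (A B : 'M[F]_(N, m)) :
  (forall i : 'I_p, tblock i *m A = tblock i *m B) -> A = B.
Proof.
move=> AB; have U := induced_basis_unit ext tw.
rewrite -[A](mulKmx U) -[B](mulKmx U) induced_basisE !mxcol_mul.
by congr (_ *m _); apply: eq_mxcol.
Qed.

Lemma tblock_free m (A B : 'I_p -> 'M[F]_(m, d.+1)) :
    \sum_(i < p) A i *m tblock i = \sum_(i < p) B i *m tblock i ->
  forall i, A i = B i.
Proof.
rewrite -!mul_mxrow_tblock => e; apply/eq_mxrowP.
exact: can_inj (mulmxK (induced_basis_unit ext tw)) _ _ e.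
Qed.

Lemma tblock_span m (w : 'M[F]_(m, N)) :
  exists A : 'I_p -> 'M[F]_(m, d.+1), w = \sum_(i < p) A i *m tblock i.
Proof.
exists (fun i => submxrow (w *m invmx (induced_basis p a sigma alpha)) i).
by rewrite -mul_mxrow_tblock submxrowK mulmxKV ?(induced_basis_unit ext tw).
Qed.

Lemma endoJ (delta : Delta) h : h \in H ->
  endo_mx delta *m sigma h = sigma h *m endo_mx delta.
Proof. by have /centgmxP/(_ h) e := endoP delta => /e. Qed.

(** By [combH], [hom_comb] and [comb_free] these are the elements of
    $\mathrm{Hom}_{\mathbb{F}H}(V,V{\uparrow})$ in coordinates over $\Delta$. By [tblock0_sum] the
    same family also encodes $\sum_i\delta_ix^i$ in the cyclic algebra. *)
Definition comb (delta : 'I_p -> Delta) : 'M[F]_(d.+1, N) :=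
  \sum_(i < p) endo_mx (delta i) *m tblock i.

Lemma combH delta h : h \in H -> comb delta *m Vup h = sigma h *m comb delta.
Proof.
move=> Hh; rewrite mulmx_suml mulmx_sumr; apply: eq_bigr => i _.
by rewrite -mulmxA tblockH // !mulmxA endoJ.
Qed.

Lemma comb_a delta : comb delta *m Vup a =
  alpha *m \sum_(i < p) endo_mx (tau (delta i)) *m tblock i.+1.
Proof.
rewrite mulmx_suml mulmx_sumr; apply: eq_bigr => i _.
by rewrite -mulmxA tblock_a mulmxA -twistJ -mulmxA.
Qed.

Lemma hom_comb (z : 'M[F]_(d.+1, N)) :
    (forall h, h \in H -> z *m Vup h = sigma h *m z) ->
  exists delta, z = comb delta.
Proof.
move=> homz; have [A zE] := tblock_span z.
have cA i : centgmx sigma (A i).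
  apply/centgmxP=> h Hh; move: i; apply: tblock_free.
  have := homz h Hh; rewrite zE mulmx_suml mulmx_sumr => e.
  under [RHS]eq_bigr do rewrite -mulmxA.
  by rewrite -e; apply: eq_bigr => i _; rewrite -[LHS]mulmxA -[RHS]mulmxA tblockH.
by exists (fun i => Endo (cA i)).
Qed.

Lemma comb_free (delta eps : 'I_p -> Delta) :
  comb delta = comb eps -> forall i, delta i = eps i.
Proof. by move=> e i; apply: val_inj; apply: (tblock_free e i). Qed.

Lemma mul_comb (gamma : Delta) delta :
  endo_mx gamma *m comb delta = comb (fun i => gamma * delta i).
Proof. by rewrite mulmx_sumr; apply: eq_bigr => i _; rewrite mulmxA. Qed.

Lemma comb_single (gamma : Delta) (j : 'I_p) :
  comb (fun i => if i == j then gamma else 0) = endo_mx gamma *m tblock j.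
Proof.
rewrite /comb (bigD1 j) //= eqxx big1 ?addr0 // => i /negPf->.
by rewrite mul0mx.
Qed.

(** $G$ is generated by $H$ and [a]: every element has the form $ha^i$. *)
Lemma centgmx_gen m (rG : mx_representation F G m) A :
    (forall h, h \in H -> A *m rG h = rG h *m A) ->
    A *m rG a = rG a *m A ->
  centgmx rG A.
Proof.
move=> cH ca; apply/centgmxP=> g Gg; have [i Hi] := Defs.transversal ext Gg.
have cX k : A *m rG (a ^+ k)%g = rG (a ^+ k)%g *m A.
  elim: k => [|k IH]; first by rewrite expg0 repr_mx1 mulmx1 mul1mx.
  by rewrite expgSr repr_mxM ?groupX // mulmxA IH -!mulmxA ca.
rewrite -[g](mulgKV (a ^+ i)%g) repr_mxM ?(groupX _ Ga) ?(subsetP sHG _ Hi) //.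
by rewrite mulmxA cH // -!mulmxA cX.
Qed.

(** * The matrices $D(\delta)$ and $X$ as endomorphisms of the induced module *)

Local Notation B := (induced_basis p a sigma alpha).
Let BU : B \in unitmx := induced_basis_unit ext tw.

(** [block_diag] and [block_shift] are relative to [induced_basis]; conjugation by [B] brings them
    to the standard basis, on which [Vup] acts. *)
Definition diag_endo_mx (delta : Delta) : 'M[F]_N :=
  invmx B *m block_diag ext tw delta *m B.
Definition shift_endo_mx : 'M[F]_N := invmx B *m block_shift ext tw *m B.

Lemma mul_basis_diag delta :
  B *m diag_endo_mx delta = block_diag ext tw delta *m B.
Proof. by rewrite /diag_endo_mx -mulmxA mulKVmx. Qed.

Lemma mul_basis_shift : B *m shift_endo_mx = block_shift ext tw *m B.
Proof. by rewrite /shift_endo_mx -mulmxA mulKVmx. Qed.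

Lemma tblock_wrap : tblock p = endo_mx lam *m tblock 0.
Proof. by rewrite -tblock_p. Qed.

(** The value $n=p$ is included so that shifting the last block needs no separate case; there it
    rests on $\alpha^p(\delta)\lambda=\lambda\delta$. *)
Lemma tblock_diag n delta : (n <= p)%N ->
  tblock n *m diag_endo_mx delta = endo_mx (iter n tau delta) *m tblock n.
Proof.
have lt_p (i : 'I_p) : tblock i *m diag_endo_mx delta =
    endo_mx (iter i tau delta) *m tblock i.
  move: i; apply/eq_mxcolP.
  rewrite -mxcol_mul -induced_basisE mul_basis_diag.
  rewrite {1}induced_basisE mul_mxblock_mxrow; apply: eq_mxcol => i.
  rewrite (bigD1 i) //= eqxx conform_mx_id big1 ?addr0 // => j.
  by rewrite eq_sym => /negPf->; rewrite mul0mx.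
rewrite leq_eqVlt => /predU1P[->|np]; last exact: (lt_p (Ordinal np)).
rewrite {1}tblock_wrap -mulmxA (lt_p (Ordinal p_gt0)) [LHS]mulmxA tblock_wrap [RHS]mulmxA.
congr (_ *m _); have e : iter p tau delta * lam = lam * delta.
  by rewrite lambda_inner mulrVK ?lambda_unit.
exact/esym/(congr1 (@endo_mx _ _ _ _ _) e).
Qed.

Lemma tblock_shift n : (n < p)%N -> tblock n *m shift_endo_mx = tblock n.+1.
Proof.
move=> np; rewrite -[n]/(val (Ordinal np)); move: (Ordinal np) => {n np} i.
move: i; apply/eq_mxcolP.
rewrite -mxcol_mul -induced_basisE mul_basis_shift.
rewrite {1}induced_basisE mul_mxblock_mxrow; apply: eq_mxcol => i.
have [ip|pi] := ltnP i.+1 p.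
  rewrite (bigD1 (Ordinal ip)) //= eqxx mul1mx big1 ?addr0 // => j.
  rewrite -val_eqE => /negPf /= ->; have [e|_] := eqVneq (i : nat) p.-1.
    by have := ip; rewrite e prednK // ltnn.
  by rewrite mul0mx.
(* In the last row the only nonzero block is $\lambda$ at the bottom left, and $\lambda$ times block
   0 is block [p]. *)
have ip : i.+1 = p by apply/anti_leq; rewrite pi ltn_ord.
have ip1 : (i == p.-1 :> nat) by rewrite -eqSS prednK // ip.
rewrite (bigD1 (Ordinal p_gt0)) //= ip1 big1 ?addr0 => [|j]; last first.
  rewrite -val_eqE => /negPf /= ->; rewrite ltn_eqF ?mul0mx //.
  by rewrite ip ltn_ord.
by rewrite ip tblock_wrap.
Qed.

Lemma diag_centgmx delta : centgmx Vup (diag_endo_mx delta).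
Proof.
apply: centgmx_gen => [h Hh|]; apply: tblock_ext => i.
  rewrite [LHS]mulmxA [RHS]mulmxA tblock_diag 1?ltnW // tblockH // -[LHS]mulmxA tblockH //.
  by rewrite -[RHS]mulmxA tblock_diag 1?ltnW // [LHS]mulmxA endoJ // [RHS]mulmxA.
rewrite [LHS]mulmxA [RHS]mulmxA tblock_diag 1?ltnW // tblock_a -[LHS]mulmxA tblock_a.
rewrite -[RHS]mulmxA tblock_diag // [LHS]mulmxA [RHS]mulmxA; congr (_ *m _).
exact/esym/twistJ.
Qed.

Lemma shift_centgmx : centgmx Vup shift_endo_mx.
Proof.
apply: centgmx_gen => [h Hh|]; apply: tblock_ext => i.
  by rewrite [LHS]mulmxA [RHS]mulmxA tblock_shift // !tblockH // -[RHS]mulmxA tblock_shift.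
rewrite [LHS]mulmxA [RHS]mulmxA tblock_shift // !tblock_a -[RHS]mulmxA; congr (_ *m _).
have [ip|pi] := ltnP i.+1 p; first by rewrite tblock_shift.
have ip : i.+1 = p by apply/anti_leq; rewrite pi ltn_ord.
have ip2 : i.+2 = (1 + p)%N by rewrite ip.
by rewrite ip2 tblock_p ip tblock_wrap -[RHS]mulmxA tblock_shift.
Qed.

Definition diag_endo delta : endo Vup := Endo (diag_centgmx delta).
Definition shift_endo : endo Vup := Endo shift_centgmx.

(* An FG-endomorphism is determined by its restriction to V: Frobenius
   reciprocity. *)
Lemma endo_ext (f g : endo Vup) :
  tblock 0 *m endo_mx f = tblock 0 *m endo_mx g -> f = g.
Proof.
move=> e; apply: val_inj; apply: tblock_ext => i.
have c (k : endo Vup) : alpha ^+ i *m (tblock i *m endo_mx k) =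
    tblock 0 *m endo_mx k *m Vup (a ^+ i)%g.
  have /centgmxP cg := endoP k; have := tblock_aX 0 i; rewrite add0n => ai.
  by rewrite -[RHS]mulmxA cg ?groupX // [RHS]mulmxA ai [LHS]mulmxA.
by apply: (can_inj (mulKmx (alphaXU i))); rewrite [LHS]c [RHS]c e.
Qed.

Lemma diag_endo_is_zmod : zmod_morphism diag_endo.
Proof.
move=> x y; apply: endo_ext; rewrite [RHS]mulmxBr !tblock_diag //=.
by rewrite mulmxBl.
Qed.
Lemma diag_endo_is_monoid : monoid_morphism diag_endo.
Proof.
split=> [|x y]; apply: endo_ext; rewrite tblock_diag //=.
  by rewrite mulmx1 mul1mx.
rewrite -[RHS]/(tblock 0 *m (diag_endo_mx x *m diag_endo_mx y)) [RHS]mulmxA.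
by rewrite tblock_diag // -[RHS]mulmxA tblock_diag // [RHS]mulmxA.
Qed.
HB.instance Definition _ := GRing.isZmodMorphism.Build _ _ _ diag_endo_is_zmod.
HB.instance Definition _ := GRing.isMonoidMorphism.Build _ _ _ diag_endo_is_monoid.

Lemma endo_mxM (x y : endo Vup) : endo_mx (x * y) = endo_mx x *m endo_mx y.
Proof. by []. Qed.

Lemma endo_mx_sum I (r : seq I) (P : pred I) (E : I -> endo Vup) :
  endo_mx (\sum_(i <- r | P i) E i) = \sum_(i <- r | P i) endo_mx (E i).
Proof. exact: (big_morph (@endo_mx _ _ _ _ Vup)). Qed.

Lemma endo_mxX (x : endo Vup) n : endo_mx (x ^+ n) = endo_mx x ^+ n.
Proof. by elim: n => // n IH; rewrite !exprS endo_mxM IH. Qed.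

Lemma tblock_shiftX n : (n <= p)%N ->
  tblock 0 *m endo_mx (shift_endo ^+ n) = tblock n.
Proof.
elim: n => [|n IH] np; first by rewrite mulmx1.
by rewrite exprSr endo_mxM mulmxA IH 1?ltnW // tblock_shift.
Qed.

Lemma shift_diag delta : shift_endo * diag_endo delta = diag_endo (tau delta) * shift_endo.
Proof.
apply: endo_ext; rewrite !endo_mxM [LHS]mulmxA [RHS]mulmxA tblock_shift //.
by rewrite !tblock_diag // -[RHS]mulmxA tblock_shift.
Qed.

Lemma shift_p : shift_endo ^+ p = diag_endo lam.
Proof.
apply: endo_ext; rewrite tblock_shiftX // tblock_diag //=.
by rewrite -tblock_p.
Qed.

Lemma tblock0_sum (delta : 'I_p -> Delta) :
  tblock 0 *m endo_mx (\sum_(i < p) diag_endo (delta i) * shift_endo ^+ i) = comb delta.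
Proof.
rewrite endo_mx_sum mulmx_sumr; apply: eq_bigr => i _.
rewrite endo_mxM [LHS]mulmxA tblock_diag // -[LHS]mulmxA tblock_shiftX //.
exact: ltnW.
Qed.

Lemma conjmx_diag_shift (delta : 'I_p -> Delta) :
  conjmx B (endo_mx (\sum_(i < p) diag_endo (delta i) * shift_endo ^+ i)) =
  \sum_(i < p) block_diag ext tw (delta i) *m block_shift ext tw ^+ i.
Proof.
rewrite /conjmx pinvmxE // endo_mx_sum mulmx_sumr mulmx_suml.
apply: eq_bigr => i _; rewrite endo_mxM endo_mxX.
have shiftX n : B *m shift_endo_mx ^+ n = block_shift ext tw ^+ n *m B.
  elim: n => [|n IH]; first by rewrite mulmx1 mul1mx.
  rewrite !exprSr -[_ * shift_endo_mx]/(_ *m _) [LHS]mulmxA IH -[LHS]mulmxA.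
  by rewrite mul_basis_shift [LHS]mulmxA.
rewrite [B *m _]mulmxA mul_basis_diag -[in LHS](mulmxA _ B) shiftX.
by rewrite [in LHS]mulmxA mulmxK.
Qed.

(** After restriction to block 0, injectivity is [comb_free] and surjectivity is [hom_comb]. As
    [cyclic_alg] carries only a ring structure, linearity over $\mathbb{F}$ is expressed through
    multiplication by the scalars of $\Delta$. *)
Lemma cyclic_alg_endo :
  exists f : {rmorphism cyclic_alg (lambda_datum ext tw) -> endo Vup},
    [/\ bijective f,
        forall (c : F) z, f (cyclicC _ (c *: (1 : Delta)) * z) = c *: f z
      & forall delta : 'I_p -> Delta,
          conjmx B (endo_mx (f (\sum_(i < p) cyclicC _ (delta i) * cyclicX _ ^+ i)))
          = \sum_(i < p) block_diag ext tw (delta i) *m block_shift ext tw ^+ i].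
Proof.
have [f [fC fX]] := cyclic_alg_lift (lambda_datum ext tw) shift_diag shift_p.
have fE (delta : 'I_p -> Delta) :
    f (\sum_(i < p) cyclicC _ (delta i) * cyclicX _ ^+ i) =
    \sum_(i < p) diag_endo (delta i) * shift_endo ^+ i.
  rewrite rmorph_sum; apply: eq_bigr => i _.
  by rewrite rmorphM rmorphXn /= fC fX.
exists f; split=> [|c z|delta].
- have f_inj : injective f.
    move=> y z; have [dy ->] := cyclic_alg_span y p_gt0.
    have [dz ->] := cyclic_alg_span z p_gt0; rewrite !fE => e.
    apply: eq_bigr => i _; congr (cyclicC _ _ * _); move: i.
    by apply: comb_free; rewrite -!tblock0_sum e.
  have f_surj phi : exists z, f z == phi.
    have [|delta e] := @hom_comb (tblock 0 *m endo_mx phi) => [h Hh|].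
      have /centgmxP cphi := endoP phi.
      rewrite -[LHS]mulmxA cphi ?(subsetP sHG) // [LHS]mulmxA tblockH //.
      by rewrite -[LHS]mulmxA.
    exists (\sum_(i < p) cyclicC _ (delta i) * cyclicX _ ^+ i).
    by apply/eqP/endo_ext; rewrite fE tblock0_sum e.
  exists (fun phi => xchoose (f_surj phi)) => [z|phi].
    by apply: f_inj; apply/eqP/(xchooseP (f_surj (f z))).
  exact/eqP/(xchooseP (f_surj phi)).
- rewrite rmorphM /= fC; apply: endo_ext; rewrite endo_mxM [LHS]mulmxA.
  rewrite -[RHS]/(tblock 0 *m (c *: endo_mx (f z))) -[RHS]scalemxAr.
  rewrite tblock_diag // [RHS]scalemxAl -[endo_mx _ in LHS]/(c *: 1%:M).
  by rewrite -[X in X *m _ = _]scalemxAl mul1mx.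
- by rewrite fE conjmx_diag_shift.
Qed.

(** * Restriction to $H$ and the ranks of submodules *)

Hypothesis sigma_irr : mx_irreducible sigma.
Local Notation rH := (subg_repr Vup sHG).

Lemma endo_unit (delta : Delta) : delta != 0 -> delta \is a GRing.unit.
Proof.
move=> nz; suff: (endo_mx delta : 'M_d.+1) \is a GRing.unit by [].
by apply: (mx_Schur sigma_irr (endoP delta)); apply: contraNneq nz => e;
  apply/eqP/val_inj.
Qed.

Lemma tblock_afforded (i : 'I_p) : afforded_by rH (tblock i) sigma.
Proof.
split=> [|h Hh]; last exact: tblockH.
apply: inj_row_free => v vt0.
have := @tblock_free _ (fun j => if j == i then v else 0) (fun=> 0).
move/(_ _ i); rewrite eqxx; apply.
rewrite [RHS]big1 => [|j _]; last by rewrite mul0mx.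
rewrite (bigD1 i) //= eqxx vt0 add0r big1 // => j /negPf->.
by rewrite mul0mx.
Qed.

Local Notation i0 := (Ordinal p_gt0).
Local Notation M0 := <<tblock i0>>%MS.

Lemma M0_simple : mxsimple rH M0.
Proof. exact: afforded_simple (tblock_afforded i0). Qed.

Lemma full_component : (1%:M <= component_mx rH M0)%MS.
Proof.
have [A ->] := tblock_span (1%:M : 'M[F]_N).
apply: summx_sub => i _; apply: submx_trans (submxMl _ _) _.
rewrite -genmxE; apply: (mx_iso_component M0_simple).
exact: (afforded_iso sigma_irr (tblock_afforded _) (tblock_afforded _)).
Qed.

(** Restricted to $H$, [W] is a direct sum of simple modules, all isomorphic to $V$ because one
    homogeneous component fills the whole module. *)
Lemma rank_submodule (W : 'M[F]_N) : mxmodule Vup W ->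
  exists s, \rank W = (s * d.+1)%N.
Proof.
move=> modW; have modWH : mxmodule rH W by exact: mxmodule_subg.
have ssimW : mxsemisimple rH W.
  apply: mxsemisimpleS modWH _ (component_mx_semisimple M0_simple).
  exact: submx_trans (submx1 _) full_component.
case: ssimW => I U /= simU defW dxW; exists #|I|.
rewrite -defW (mxdirectP dxW) /= -sum_nat_const; apply: eq_bigr => i _.
rewrite -(mxrank_iso (component_mx_iso M0_simple (simU i) _)).
  exact: afforded_rank (tblock_afforded i0).
exact: submx_trans (submx1 _) full_component.
Qed.

(** A simple $\mathbb{F}H$-submodule of [W] is a copy of $V$; transporting the basis along the
    isomorphism gives an $\mathbb{F}H$-map, which [hom_comb] expands in the blocks. *)
Lemma submodule_comb (W : 'M[F]_N) : mxmodule Vup W -> W != 0 ->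
  exists2 delta, afforded_by rH (comb delta) sigma & (comb delta <= W)%MS.
Proof.
move=> modW nzW; have modWH : mxmodule rH W by exact: mxmodule_subg.
have [M simM sMW] := mxsimple_sub_exists modWH nzW.
have isoM : mx_iso rH M0 M.
  apply: (component_mx_iso M0_simple simM).
  exact: submx_trans (submx1 _) full_component.
have [z affz zM] := iso_afforded (tblock_afforded i0) isoM.
have [freez zJ] := affz.
have [delta zE] := hom_comb zJ.
by exists delta; rewrite -zE // zM.
Qed.

Lemma submodule_tblock_full (W : 'M[F]_N) i :
  mxmodule Vup W -> (tblock i <= W)%MS -> (1%:M <= W)%MS.
Proof.
move=> /mxmoduleP modW sW.
have s0 : (tblock 0 <= W)%MS.
  have := tblock_aX 0 i; rewrite add0n => e.
  have -> : tblock 0 = alpha ^+ i *m tblock i *m Vup ((a ^+ i)^-1)%g.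
    rewrite -e -[RHS]mulmxA -repr_mxM ?groupV ?groupX //.
    by rewrite mulgV repr_mx1 mulmx1.
  rewrite (submx_trans (submxMr _ _) (modW _ _)) ?groupV ?groupX //.
  exact: mulmx_sub.
have sn n : (tblock n <= W)%MS.
  elim: n => // n IH.
  have -> : tblock n.+1 = invmx alpha *m (tblock n *m Vup a).
    by rewrite tblock_a mulKmx.
  by apply: mulmx_sub; apply: submx_trans (submxMr _ IH) (modW _ Ga).
have [A ->] := tblock_span (1%:M : 'M[F]_N).
by apply: summx_sub => j _; apply: mulmx_sub.
Qed.

(** This is right multiplication by [gamma] in the cyclic algebra, where
    $x^i\gamma=\alpha^i(\gamma)x^i$; [mul_comb] is the left one. *)
Lemma comb_diag delta gamma :
  comb delta *m diag_endo_mx gamma = comb (fun i => delta i * iter i tau gamma).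
Proof.
rewrite mulmx_suml; apply: eq_bigr => i _.
by rewrite -[LHS]mulmxA tblock_diag 1?ltnW // [LHS]mulmxA.
Qed.

Lemma twist_inj : injective tau.
Proof.
move=> x y e; apply: val_inj; apply: (can_inj (mulmxK aU)).
by rewrite -[LHS]twistJ -[RHS]twistJ e.
Qed.

(** [tau] is onto because its [p]-th power is inner, and a surjective ring endomorphism maps the
    centre into itself. *)
Lemma central_iter n z : central z -> central (iter n tau z).
Proof.
move=> cz; elim: n => // n IH x.
have [y <-] : exists y, tau y = x.
  exists (iter p.-1 tau (lam^-1 * x * lam)).
  by rewrite -iterS prednK // lambda_inner !mulrA mulrV ?mulrK ?mul1r ?lambda_unit.
by rewrite iterS -!rmorphM IH.
Qed.

(** * The order of $\alpha$ on the centre and the decomposition into simple submodules *)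

Hypothesis ord_tau : order_on_center tau p.

Lemma central_separates (i j : 'I_p) : i != j ->
  exists2 z, central z & iter i tau z != iter j tau z.
Proof.
wlog ij : i j / (i < j)%N.
  move=> IH ne; have := ne; rewrite -val_eqE /= neq_ltn => /orP[] /IH; first exact.
  by rewrite eq_sym => /(_ ne) [z cz nz]; exists z => //; rewrite eq_sym.
move=> _; have [_ _ /(_ (j - i)%N)] := ord_tau.
rewrite subn_gt0 ij (leq_ltn_trans (leq_subr _ _)) // => /(_ isT) [z cz /eqP nz].
exists z => //; apply: contraNneq nz.
have -> : iter j tau z = iter i tau (iter (j - i) tau z).
  by rewrite -iterD subnKC // ltnW.
move: (j - i)%N => k; elim: (i : nat) => [/= <- //|n IH].
by rewrite !iterS => /twist_inj.
Qed.

(* An element of minimal support in a nonzero two-sided ideal of the cyclic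
   algebra has only one term: commuting with a central element of Delta that
   separates two terms would shorten it. *)
Lemma invariant_submodule_full (W : 'M[F]_N) : mxmodule Vup W -> W != 0 ->
  (forall f, centgmx Vup f -> (W *m f <= W)%MS) -> (1%:M <= W)%MS.
Proof.
move=> modW nzW invW; have [delta0 [free0 _] sW0] := submodule_comb modW nzW.
have shorten n (delta : 'I_p -> Delta) : (#|[pred i | delta i != 0%R]| <= n)%N ->
    (comb delta <= W)%MS -> (exists j, delta j != 0) -> (1%:M <= W)%MS.
  elim: n delta => [|n IH] delta card_delta sW [j nzj].
    by move: card_delta; rewrite leqn0 => /eqP/card0_eq/(_ j); rewrite inE nzj.
  have Uj := endo_unit nzj.
  case: (pickP [pred i | (i != j) && (delta i != 0)]) => [i /andP[ij nzi] | single].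
    have [z cz nz] := central_separates ij.
    (* The coefficients of $\alpha^j(z)y-yz$, where $y$ has coefficients [delta]; $\alpha^j(z)$
       being central, it may stand on the right. The term at [j] dies and the one at [i]
       survives. *)
    pose delta' k := delta k * (iter j tau z - iter k tau z).
    have sW' : (comb delta' <= W)%MS.
      have -> : comb delta' = endo_mx (iter j tau z) *m comb delta -
                              comb delta *m diag_endo_mx z.
        rewrite mul_comb comb_diag -sumrB; apply: eq_bigr => k _.
        by rewrite -mulmxBl /delta' mulrBr -(central_iter j cz).
      rewrite addmx_sub ?mulmx_sub // eqmx_opp.
      exact: submx_trans (submxMr _ sW) (invW _ (diag_centgmx z)).
    apply: (IH delta') => //.
      rewrite -ltnS; apply: leq_trans card_delta; apply: proper_card.
      apply/properP; split; last first.
        by exists j; rewrite !inE // /delta' subrr mulr0 eqxx.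
      apply/subsetP=> k; rewrite !inE; apply: contraNneq => k0.
      by rewrite /delta' k0 mul0r.
    exists i; apply: contraNneq nz => e; rewrite eq_sym -subr_eq0.
    by apply/eqP/(mulrI (endo_unit nzi)); rewrite mulr0.
  apply: (@submodule_tblock_full _ j modW).
  suff e : comb delta = endo_mx (delta j) *m tblock j.
    have -> : tblock j = invmx (endo_mx (delta j)) *m comb delta.
      by rewrite e mulKmx.
    exact: mulmx_sub.
  rewrite -comb_single; apply: eq_bigr => k _; have [->//|kj] := eqVneq k j.
  by have := single k; rewrite /= kj => /negbFE/eqP ->.
apply: (shorten _ _ (leqnn _) sW0).
apply/existsP; apply: contraTT isT; rewrite negb_exists => /forallP z0.
have comb0 : comb delta0 = 0.
  by rewrite /comb big1 // => i _; rewrite (eqP (negbNE (z0 i))) mul0mx.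
by move: free0; rewrite comb0 /row_free mxrank0.
Qed.

(** The homogeneous component of [W] is nonzero and stable under every endomorphism, so it is the
    whole module by [invariant_submodule_full]. *)
Lemma simple_decomposition (W : 'M[F]_N) : mxsimple Vup W ->
  exists (I : finType) (U : I -> 'M[F]_N), [/\ forall i, mxsimple Vup (U i),
    forall i, mx_iso Vup W (U i), (\sum_i U i :=: 1%:M)%MS
    & mxdirect (\sum_i U i)].
Proof.
move=> simW; have modC := component_mx_module Vup W.
have C1 : (1%:M <= component_mx Vup W)%MS.
  apply: (invariant_submodule_full modC).
    have [_ nzW _] := simW; apply: contraNneq nzW => C0.
    by rewrite -submx0 -C0 component_mx_id.
  by move=> f cf; apply: (hom_component_mx simW); apply: centgmx_hom.
have [I U /= simU defC dxC] := component_mx_semisimple simW.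
have defU : (\sum_i U i :=: 1%:M)%MS.
  by apply: eqmx_trans defC _; apply/eqmxP; rewrite submx1.
exists I, U; split=> // i; apply: (component_mx_iso simW) => //.
exact: submx_trans (submx1 _) C1.
Qed.

(** Counting dimensions over the copies of [W], each of rank [s * d.+1], gives [p = #|I| * s];
    primality leaves $s=1$ or $s=p$. *)
Lemma simple_rank (W : 'M[F]_N) : mxsimple Vup W ->
  \rank W = d.+1 \/ (1%:M <= W)%MS.
Proof.
move=> simW; have [I [U [simU isoU defU dxU]]] := simple_decomposition simW.
have [modW nzW _] := simW.
have [s rankW] := rank_submodule modW.
have p_fact : p = (#|I| * s)%N.
  apply/eqP; rewrite -(eqn_pmul2r (ltn0Sn d)) -mulnA -rankW; apply/eqP.
  have : \rank (\sum_i U i)%MS = N by rewrite defU mxrank1.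
  rewrite (mxdirectP dxU) /= /induced_dim [RHS]sum_nat_const card_ord => <-.
  by rewrite -sum_nat_const; apply: eq_bigr => i _; rewrite (mxrank_iso (isoU i)).
have [_ /(_ s)] := primeP (ext_prime ext).
rewrite {1}p_fact dvdn_mull // => /(_ isT) /orP[/eqP s1 | /eqP sp].
  by left; rewrite rankW s1 mul1n.
right; rewrite sub1mx /row_full rankW sp.
by rewrite /induced_dim sum_nat_const card_ord.
Qed.

(** * The submodules $U(\mu)$ *)

Definition twisted_root (mu : Delta) :=
  mu \is a GRing.unit /\ left_pow tau mu p = lam^-1.

Lemma U_basis_comb mu :
  U_basis ext tw mu = comb (fun i => left_pow tau mu i).
Proof.
apply/row_matrixP=> i; rewrite !rowE U_basisE mulmx_sumr.
apply: eq_bigr => j _; rewrite -mul_tens_mx /U_coef /tblock.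
by rewrite -[_ * _]/(_ *m _) !mulmxA.
Qed.

Lemma U_basisH mu h : h \in H ->
  U_basis ext tw mu *m Vup h = sigma h *m U_basis ext tw mu.
Proof. by move=> Hh; rewrite U_basis_comb combH. Qed.

Lemma U_basis_free mu : row_free (U_basis ext tw mu).
Proof.
apply: inj_row_free => v; rewrite U_basis_comb mulmx_sumr => e.
have := @tblock_free _ (fun i => v *m endo_mx (left_pow tau mu i)) (fun=> 0).
move/(_ _ (Ordinal p_gt0)); rewrite /= mulmx1; apply.
rewrite [RHS]big1 => [|i _]; last by rewrite mul0mx.
by rewrite -[RHS]e; apply: eq_bigr => i _; rewrite [RHS]mulmxA.
Qed.

(** Since $\alpha(\mu^{\sqsupset i})=\mu^{-1}\mu^{\sqsupset(i+1)}$, acting by [a] shifts the sum and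
    leaves the factor $\alpha\mu^{-1}$; the cycle closes because $\mu^{\sqsupset p}\lambda=1$. *)
Lemma U_basis_a mu : twisted_root mu -> U_basis ext tw mu *m Vup a =
  alpha * endo_mx mu^-1 *m U_basis ext tw mu.
Proof.
move=> [muU mup]; rewrite U_basis_comb comb_a -[RHS]mulmxA; congr (_ *m _).
pose f n := endo_mx (left_pow tau mu n) *m tblock n.
have fp : f p = f 0%N.
  rewrite /f mup tblock_wrap [LHS]mulmxA; congr (_ *m _).
  have : lam^-1 * lam = 1 by rewrite mulVr ?lambda_unit.
  by move/(congr1 (@endo_mx _ _ _ _ _)).
rewrite /comb -(sum_wrap fp) mulmx_sumr; apply: eq_bigr => i _.
rewrite /f left_powSl [RHS]mulmxA; congr (_ *m _).
by rewrite -[RHS]/(endo_mx (mu^-1 * (mu * tau (left_pow tau mu i)))) mulKr.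
Qed.

Lemma U_module mu : twisted_root mu -> mxmodule Vup (U_basis ext tw mu).
Proof.
move=> rmu; apply/mxmoduleP=> g Gg; have [i Hi] := Defs.transversal ext Gg.
have sX k : (U_basis ext tw mu *m Vup (a ^+ k)%g <= U_basis ext tw mu)%MS.
  elim: k => [|k IH]; first by rewrite expg0 repr_mx1 mulmx1.
  rewrite expgSr repr_mxM ?groupX // mulmxA; apply: submx_trans (submxMr _ IH) _.
  by rewrite U_basis_a // submxMl.
rewrite -[g](mulgKV (a ^+ i)%g) repr_mxM ?(groupX _ Ga) ?(subsetP sHG _ Hi) //.
rewrite mulmxA U_basisH // -mulmxA; apply: mulmx_sub; exact: sX.
Qed.

Lemma U_affords mu : twisted_root mu ->
  exists rho : mx_representation F G d.+1, afforded_by Vup (U_basis ext tw mu) rho.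
Proof. by move=> rmu; apply: afforded_exists (U_basis_free mu) (U_module rmu). Qed.

Lemma afforded_U mu (rho : mx_representation F G d.+1) : twisted_root mu ->
    afforded_by Vup (U_basis ext tw mu) rho ->
  rho a = alpha * endo_mx mu^-1 /\ forall h, h \in H -> rho h = sigma h.
Proof.
move=> rmu [freeU UJ]; split=> [|h Hh]; apply: (row_free_inj freeU).
  by rewrite -[LHS]UJ // U_basis_a.
by rewrite -[LHS]UJ ?(subsetP sHG) // U_basisH.
Qed.

Lemma U_afforded mu : afforded_by rH (U_basis ext tw mu) sigma.
Proof. by split=> [|h Hh]; [apply: U_basis_free | apply: U_basisH]. Qed.

Lemma U_simple mu : twisted_root mu -> mxsimple Vup (U_space ext tw mu).
Proof.
move=> rmu; apply: (mxsimple_subg (sHG := sHG)).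
  by rewrite (eqmx_module _ (genmxE _)) U_module.
exact: afforded_simple (U_afforded mu).
Qed.

Lemma U_rank mu : \rank (U_space ext tw mu) = d.+1.
Proof. exact: afforded_rank (U_afforded mu). Qed.

Lemma U_rsim mu (U : 'M[F]_N) (modU : mxmodule Vup U) : twisted_root mu ->
  (U :=: U_basis ext tw mu)%MS -> mx_rsim (subg_repr (submod_repr modU) sHG) sigma.
Proof.
move=> rmu UE; have [rho aff] := U_affords rmu.
have [C dim freeC CJ] := afforded_rsim modU aff UE.
have [_ rhoH] := afforded_U rmu aff.
exists C => // h Hh; rewrite -rhoH //; exact: (CJ h (subsetP sHG h Hh)).
Qed.

(* A submodule V(sum_i e_i alpha^-i a^i) is stable under a iff a acts on its
   coefficients by some nu in Delta, which forces e_i = e_0 mu^[i] for a mu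
   that is twisted-conjugate to nu^-1 by e_0. *)
Lemma submodule_is_U (W : 'M[F]_N) : mxmodule Vup W -> \rank W = d.+1 ->
  exists2 mu, twisted_root mu & (U_space ext tw mu :=: W)%MS.
Proof.
move=> modW rankW; have nzW : W != 0 by rewrite -mxrank_eq0 rankW.
have [delta [free_z zJ] sW] := submodule_comb modW nzW.
(* The coefficients are extended by 0 to all naturals, so that the recurrence can be written with
   [n.+1] and [p.-1]. *)
pose e n : Delta := oapp delta 0 (insub n).
have eE (i : 'I_p) : e i = delta i by rewrite /e valK.
set z := comb delta in free_z zJ sW.
have zE : z = \sum_(i < p) endo_mx (e i) *m tblock i.
  by apply: eq_bigr => i _; rewrite eE.
have zW : (z :=: W)%MS.
  by apply/eqmxP/andP; split=> //; rewrite -(mxrank_leqif_sup sW) rankW (eqP free_z).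
have /submxP[C Cz] : (z *m Vup a <= z)%MS.
  by rewrite zW; apply: submx_trans (mxmoduleP modW a Ga); rewrite submxMr ?zW.
pose z' := \sum_(i < p) endo_mx (tau (e i)) *m tblock i.+1.
have za : z *m Vup a = alpha *m z'.
  by rewrite comb_a; congr (_ *m _); apply: eq_bigr => i _; rewrite eE.
(* [C] is the matrix of [a] in the basis [z], so [invmx alpha *m C] takes [z] to [z']. Both are
   $\mathbb{F}H$-maps and [z] is free, hence this matrix lies in $\Delta$. *)
have nu_c : centgmx sigma (invmx alpha *m C).
  have nuz : invmx alpha *m C *m z = z' by rewrite -mulmxA -Cz za mulKmx.
  apply/centgmxP=> h Hh; apply: (row_free_inj free_z) => /=.
  rewrite -[LHS]mulmxA -zJ // [LHS]mulmxA nuz -[RHS]mulmxA nuz mulmx_suml mulmx_sumr.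
  apply: eq_bigr => i _.
  by rewrite -[LHS]mulmxA tblockH // [LHS]mulmxA endoJ // [RHS]mulmxA.
pose nu : Delta := Endo nu_c.
(* The coefficients of [z'] on blocks [0] to [p.-1]: block [p] is $\lambda$ times block 0, which
   puts $\lambda$ into the coefficient at 0. The branch [m.+1 == p] makes [f p] equal to [f 0], for
   use with [sum_wrap]. *)
pose f n := endo_mx (if n is m.+1 then
  if m.+1 == p then tau (e m) * lam else tau (e m) else tau (e p.-1) * lam).
have nuz : endo_mx nu *m z = \sum_(i < p) f i *m tblock i.
  rewrite -mulmxA -Cz za mulKmx //.
  pose g n := f n *m tblock (if n == p then 0 else n).
  transitivity (\sum_(i < p) g i.+1).
    apply: eq_bigr => i _; rewrite /g /f; case: eqVneq => // ->.
    by rewrite tblock_wrap [LHS]mulmxA.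
  have gp : g p = g 0%N.
    rewrite /g eqxx /= (ltn_eqF p_gt0); congr (_ *m _).
    have fS m : m.+1 = p -> f m.+1 = f 0%N.
      move=> mp; have pm : p.-1 = m by rewrite -mp.
      by rewrite /f pm mp eqxx.
    by have := fS _ (prednK p_gt0); rewrite prednK.
  rewrite (sum_wrap gp); apply: eq_bigr => i _.
  by rewrite /g ltn_eqF.
have rec (i : 'I_p) : endo_mx (nu * e i) = f i.
  move: i; apply: tblock_free; rewrite -nuz zE mulmx_sumr.
  by apply: eq_bigr => i _; rewrite [RHS]mulmxA.
have rec0 : nu * e 0%N = tau (e p.-1) * lam.
  by apply: val_inj; apply: (rec i0).
have recS n : (n.+1 < p)%N -> nu * e n.+1 = tau (e n).
  move=> np; apply: val_inj; have := rec (Ordinal np); rewrite /f /=.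
  by rewrite (ltn_eqF np).
have nz_z : z != 0 by rewrite -mxrank_eq0 (eqP free_z).
(* If [nu] were 0, the invertible operator [a] would annihilate [z]. *)
have nuU : nu \is a GRing.unit.
  apply: endo_unit; apply: contraNneq nz_z => nu0.
  have : z *m Vup a = 0.
    by rewrite za -(mulKVmx aU (_ *m _)) -za Cz [invmx _ *m _]mulmxA
      -[_ *m C]/(endo_mx nu) nu0 mul0mx mulmx0.
  move/(congr1 (mulmx^~ (invmx (Vup a)))).
  by rewrite mulmxK ?repr_mx_unit // mul0mx => ->.
pose c := e 0%N.
(* Forced by the first step of the recurrence: $\nu e_1=\alpha(e_0)$ with $e_0=c$ and $e_1=c\mu$. *)
pose mu := c^-1 * nu^-1 * tau c.
have cU : c \is a GRing.unit.
  apply: endo_unit; apply: contraNneq nz_z => c0.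
  have e0 n : (n < p)%N -> e n = 0.
    elim: n => // n IH np; apply: (mulrI nuU).
    by rewrite recS // IH 1?ltnW // rmorph0 mulr0.
  by rewrite zE big1 // => i _; rewrite e0 // mul0mx.
have tau_cU : tau c \is a GRing.unit by rewrite rmorph_unit.
have e_pow n : (n < p)%N -> e n = c * left_pow tau mu n.
  elim: n => [|n IH] np; first by rewrite mulr1.
  apply: (mulrI nuU); rewrite recS // IH 1?ltnW // left_powSl rmorphM /mu.
  by rewrite !mulrA mulrK // mulrV // mul1r.
(* The wrap-around relation [rec0] gives $\mu^{\sqsupset
   p}\lambda=c^{-1}\nu^{-1}\alpha(e_{p-1})\lambda=c^{-1}\nu^{-1}\nu c=1$. *)
have mu_p : left_pow tau mu p = lam^-1.
  apply: (mulIr (lambda_unit ext tw)); rewrite mulVr ?lambda_unit //.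
  have := left_powSl tau mu p.-1; rewrite prednK // => ->.
  have := rec0; rewrite (e_pow p.-1) ?prednK // rmorphM.
  move: (left_pow tau mu p.-1) => L r0.
  by rewrite /mu -!mulrA [tau c * _]mulrA -r0 mulKr // mulVr.
have muU : mu \is a GRing.unit.
  by rewrite /mu !unitrMl ?unitrV.
exists mu => //.
have zU : z = endo_mx c *m U_basis ext tw mu.
  rewrite zE U_basis_comb mulmx_sumr; apply: eq_bigr => i _.
  by rewrite e_pow // [RHS]mulmxA.
apply: eqmx_trans (genmxE _) _; apply: eqmx_trans zW; rewrite zU.
by apply/eqmx_sym/eqmxMfull; rewrite row_full_unit.
Qed.

(** Commuting with $H$ places [A] in $\Delta$; by [centgmx_gen] only the action of [a] remains to be
    tested. *)
Lemma centgmx_afforded (mu : Delta) (rho : mx_representation F G d.+1) (A : 'M[F]_d.+1) :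
    rho a = alpha * endo_mx mu^-1 -> (forall h, h \in H -> rho h = sigma h) ->
  centgmx rho A <-> exists2 delta : Delta, endo_mx delta = A
    & GRing.comm (endo_mx delta) (alpha * endo_mx mu^-1).
Proof.
move=> rho_a rhoH; split=> [/centgmxP cA | [delta <- cdelta]].
  have cAH : centgmx sigma A.
    by apply/centgmxP=> h Hh; rewrite -rhoH // cA ?(subsetP sHG).
  by exists (Endo cAH) => //; rewrite -rho_a; apply: cA.
apply: centgmx_gen => [h Hh|]; first by rewrite rhoH // endoJ.
by rewrite rho_a.
Qed.

Lemma comm_conj (mu delta : Delta) : mu \is a GRing.unit ->
  GRing.comm (endo_mx delta) (alpha * endo_mx mu^-1) <->
  alpha^-1 * endo_mx delta * alpha = endo_mx mu^-1 * endo_mx delta * endo_mx mu.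
Proof.
move=> muU.
have VM : endo_mx mu^-1 * endo_mx mu = 1
  by have /(congr1 (@endo_mx _ _ _ _ _)) := mulVr muU.
have MV : endo_mx mu * endo_mx mu^-1 = 1
  by have /(congr1 (@endo_mx _ _ _ _ _)) := mulrV muU.
split=> [c | e].
  have := congr1 (fun A => alpha^-1 * (A * endo_mx mu)) c.
  by rewrite -!mulrA VM mulr1 !mulrA mulVr // mul1r => <-.
have := congr1 (fun A => alpha * (A * endo_mx mu^-1)) e.
by rewrite -!mulrA MV mulr1 !mulrA mulrV // mul1r /GRing.comm !mulrA.
Qed.

(** * The irreducible case and the split case *)

Lemma simple_induced : ~ (exists mu, twisted_root mu) -> mx_irreducible Vup.
Proof.
move=> no_root; split=> [||U modU _ nzU]; first exact: mxmodule1.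
  by rewrite -mxrank_eq0 mxrank1 /induced_dim sum_nat_const card_ord -lt0n
    muln_gt0 p_gt0.
have [W simW sWU] := mxsimple_sub_exists modU nzU.
have [rankW | W1] := simple_rank simW; last exact: submx_trans W1 sWU.
have [modW _ _] := simW.
by case: no_root; have [mu rmu _] := submodule_is_U modW rankW; exists mu.
Qed.

(** All summands are isomorphic to $U(\mu)$, hence of rank [d.+1]; counting ranks gives [p] of them,
    and [submodule_is_U] presents each as some $U(\nu)$. *)
Lemma twisted_root_decomposition : (exists mu, twisted_root mu) ->
  exists mu_ : 'I_p -> Delta,
    [/\ forall j, twisted_root (mu_ j),
        (\sum_(j < p) U_space ext tw (mu_ j) :=: 1%:M)%MS,
        mxdirect (\sum_(j < p) U_space ext tw (mu_ j))
      & forall j k, mx_iso Vup (U_space ext tw (mu_ j)) (U_space ext tw (mu_ k))].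
Proof.
case=> mu rmu; have simW := U_simple rmu.
have [I [U [simU isoU defU dxU]]] := simple_decomposition simW.
have rankU i : \rank (U i) = d.+1 by rewrite -(mxrank_iso (isoU i)) U_rank.
have cardI : #|I| = p.
  apply/eqP; rewrite -(eqn_pmul2r (ltn0Sn d)); apply/eqP.
  have : \rank (\sum_i U i)%MS = N by rewrite defU mxrank1.
  rewrite (mxdirectP dxU) /= /induced_dim [RHS]sum_nat_const card_ord => <-.
  by rewrite -sum_nat_const; apply: eq_bigr => i _; rewrite rankU.
have /fin_all_exists[nu nuP] i : exists nu,
    twisted_root nu /\ (U_space ext tw nu :=: U i)%MS.
  have [modUi _ _] := simU i.
  by have [nu] := submodule_is_U modUi (rankU i); exists nu.
pose ix (j : 'I_p) : I := enum_val (cast_ord (esym cardI) j).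
have ix_bij : bijective ix.
  apply: bij_comp; first exact: enum_val_bij.
  by exists (cast_ord cardI) => j; rewrite ?cast_ordK ?cast_ordKV.
have sumE : (\sum_(j < p) U_space ext tw (nu (ix j)) :=: 1%:M)%MS.
  apply: eqmx_trans defU.
  rewrite (reindex ix) /=; last exact: onW_bij.
  by apply: eqmx_sums => j _; have [_] := nuP (ix j).
exists (nu \o ix); split=> [j|||j k] //=.
- by have [] := nuP (ix j).
(* Directness by counting: the ranks of the summands add up to that of the whole module. *)
- apply/mxdirectP => /=; rewrite sumE mxrank1 (eq_bigr (fun=> d.+1)) //.
  by move=> j _; apply: U_rank.
- have [_ Ej] := nuP (ix j); have [_ Ek] := nuP (ix k).
  apply: mx_iso_trans (eqmx_iso _ Ej) _.
  apply: mx_iso_trans (mx_iso_sym (isoU _)) _.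
  exact: mx_iso_trans (isoU _) (eqmx_iso _ (eqmx_sym Ek)).
Qed.
End Induced.

Theorem theorem5 (F : fieldType) (gT : finGroupType) (G H : {group gT})
    (p : nat) (a : gT) (ext : prime_extension G H p a)
    (d : nat) (sigma : mx_representation F H d.+1)
    (sigma_irr : mx_irreducible sigma) (sigma_stable : stable_repr G sigma)
    (alpha : 'M[F]_d.+1) (tw : twisting a sigma alpha)
    (ord_alpha : order_on_center (twist ext tw) p) :
  let Delta := endo sigma in
  let lam : Delta := lambda ext tw in
  let dat := lambda_datum ext tw in
  let Vup := induced_repr ext sigma in
  let solution (mu : Delta) :=
    mu \is a GRing.unit /\ left_pow (twist ext tw) mu p = lam^-1 in
  let U (mu : Delta) := U_space ext tw mu in
  [/\ (~ (exists mu : Delta, solution mu) ->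
        mx_irreducible Vup /\
        exists f : {rmorphism cyclic_alg dat -> endo Vup},
          [/\ bijective f,
              forall (c : F) (z : cyclic_alg dat), f (cyclicC dat (c *: (1 : Delta)) * z) = c *: f z
            & forall delta : 'I_p -> Delta,
                conjmx (induced_basis p a sigma alpha)
                  (endo_mx
                     (f (\sum_(i < p) cyclicC dat (delta i) * cyclicX dat ^+ i)))
                = \sum_(i < p) block_diag ext tw (delta i)
                                 *m block_shift ext tw ^+ i]),
      ((exists mu : Delta, solution mu) ->
        exists mu_ : 'I_p -> Delta,
          [/\ forall j, solution (mu_ j),
              (\sum_(j < p) U (mu_ j) :=: 1%:M)%MS,
              mxdirect (\sum_(j < p) U (mu_ j)),
              forall j, mxsimple Vup (U (mu_ j))
            & (forall j k, mx_iso Vup (U (mu_ j)) (U (mu_ k))) /\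
              (forall j, exists modU : mxmodule Vup (U (mu_ j)),
                mx_rsim (subg_repr (submod_repr modU) (ext_sub ext)) sigma)])
    & forall mu : Delta, solution mu ->
        (exists rho : mx_representation F G d.+1,
          afforded_by Vup (U_basis ext tw mu) rho) /\
        (forall rho : mx_representation F G d.+1,
          afforded_by Vup (U_basis ext tw mu) rho ->
          [/\ rho a = alpha * endo_mx mu^-1,
              forall h, h \in H -> rho h = sigma h,
              forall A : 'M[F]_d.+1, centgmx rho A <->
                exists2 delta : Delta, endo_mx delta = A
                  & GRing.comm (endo_mx delta) (alpha * endo_mx mu^-1)
            & forall delta : Delta,
                GRing.comm (endo_mx delta) (alpha * endo_mx mu^-1) <->
                alpha^-1 * endo_mx delta * alpha
                  = endo_mx mu^-1 * endo_mx delta * endo_mx mu])].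
Proof.
move=> Delta lam dat Vup solution U.
split=> [no_sol | sol | mu [muU mup]].
- split; last exact: cyclic_alg_endo.
  exact: (simple_induced sigma_irr ord_alpha no_sol).
- have [mu_ [rmu sumU dxU isoU]] := twisted_root_decomposition sigma_irr ord_alpha sol.
  exists mu_; split=> // [j|].
    exact: (U_simple sigma_irr (rmu j)).
  split=> // j; have [modU _ _] := U_simple sigma_irr (rmu j).
  by exists modU; apply: U_rsim (rmu j) (genmxE _).
- have rmu : twisted_root ext tw mu by [].
  split=> [|rho aff]; first exact: (U_affords rmu).
  have [rho_a rhoH] := afforded_U rmu aff.
  split=> // [A|delta]; first exact: (centgmx_afforded ext).
  exact: (comm_conj tw delta muU).
Qed.
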